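(* Let $\Omega$ be a bounded open subset of $\mathbb{R}^{d_0}$ and let $X$ be a reflexive Banach space with $1$-symmetric basis. Then the space $JF_X(\Omega)$ does not contain an isomorphic copy of $\ell_1$.
   Context: Let $X$ be a (infinite-dimensional, real) reflexive Banach space with norm $\|\cdot\|_X$ and a $1$-symmetric basis $(e_n)_{n}$, i.e. $\|\sum_n \epsilon_n a_n e_{\pi(n)}\|_X=\|\sum_n a_n e_n\|_X$ for all finitely supported real $(a_n)$, all signs $\epsilon_n\in\{-1,1\}$ and all permutations $\pi$ of $\mathbb{N}$. For a (nonempty) bounded open set $\Omega\subset\mathbb{R}^{d_0}$, $\mathcal{P}(\Omega)$ denotes the set of all open parallelepipeds $T=\prod_{d=1}^{d_0}(\alpha_d,\beta_d)$, $\alpha_d<\beta_d$, with $T\subset\Omega$. With $\mu$ Lebesgue measure, $JF_X(\Omega)$ is the completion of $L^1(\Omega)$ under the norm $\|f\|_{JF_X(\Omega)}=\sup\{\|\sum_{j=1}^m(\int_{T_j}f\,d\mu)e_j\|_X : m\in\mathbb{N},\ T_1,\dots,T_m\in\mathcal{P}(\Omega)\text{ pairwise disjoint}\}$. *)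

(* Defs.v *)
From HB Require Import structures.
From mathcomp Require Import all_boot all_order all_algebra.
From mathcomp Require Import all_classical all_reals all_analysis.
Set Implicit Arguments.
Unset Strict Implicit.
Unset Printing Implicit Defensive.
Import Order.TTheory GRing.Theory Num.Theory.
Import numFieldNormedType.Exports.
Local Open Scope classical_set_scope.
Local Open Scope ring_scope.

Section Dual.
Context (R : realType) (X : normedModType R).

Definition dual_pred : {pred X -> R^o} :=
  mem [set f : X -> R^o | linear f /\ continuous f].

Lemma dual_submod_closed : submod_closed dual_pred.
Proof.
split=> [|a f g].
  rewrite inE; split; last exact: cst_continuous.
  by move=> a x y; rewrite [LHS]/= [RHS]/= scaler0 addr0.
rewrite !inE => -[lf cf] [lg cg]; split=> [b x y|x].
  change (a *: f (b *: x + y) + g (b *: x + y) =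
          b *: (a *: f x + g x) + (a *: f y + g y)).
  rewrite lf lg !scalerDr !scalerA [b * a]mulrC -!addrA; congr (_ + _).
  by rewrite addrCA.
apply: cvgD; last exact: cg.
by apply: cvgZr; exact: cf.
Qed.

HB.instance Definition _ := GRing.isSubmodClosed.Build _ _ dual_pred
  dual_submod_closed.

Definition dual := {f : X -> R^o | f \in dual_pred}.
HB.instance Definition _ := SubType.on dual.
HB.instance Definition _ := Choice.on dual.
HB.instance Definition _ := [SubChoice_isSubLmodule of dual by <:].

Definition dual_fun (f : dual) : X -> R^o := val f.
Coercion dual_fun : dual >-> Funclass.

Definition dual_norm (f : dual) : R :=
  sup [set `|f x| | x in [set x : X | `|x| <= 1]].

Lemma dual_has_sup (f : dual) :
  has_sup [set `|f x| | x in [set x : X | `|x| <= 1]].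
Proof.
split; first by exists `|f 0|, 0 => //=; rewrite normr0.
case: f => f /[dup] + fP; rewrite inE => -[lf cf].
pose Lf := GRing.isLinear.Build _ _ _ _ f lf.
pose fL : {linear X -> R^o} := HB.pack f Lf.
have /linear_boundedP[M [Mr]] : bounded_near fL (nbhs 0).
  by apply: continuous_linear_bounded; exact: (cf 0).
move=> /(_ (M + 1)); rewrite ltrDl ltr01 => /(_ isT) fM.
exists `|M + 1| => _ [x /= x1 <-].
apply: (le_trans (fM x)); apply: (le_trans (ler_norm _)).
by rewrite normrM normr_id ler_piMr.
Qed.

Lemma le_dual_norm (f : dual) (x : X) : `|x| <= 1 -> `|f x| <= dual_norm f.
Proof. by move=> x1; apply: (ub_le_sup (dual_has_sup f).2); exists x. Qed.

Lemma dual_norm_le (f : dual) (M : R) :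
  (forall x : X, `|x| <= 1 -> `|f x| <= M) -> dual_norm f <= M.
Proof.
by move=> fM; apply: ge_sup (dual_has_sup f).1 _ => _ [x /= x1 <-]; exact: fM.
Qed.

Lemma dual_norm_ge0 (f : dual) : 0 <= dual_norm f.
Proof. by apply: le_trans (@le_dual_norm f 0 _); rewrite ?normr0. Qed.

Lemma dual_normD (f g : dual) : dual_norm (f + g) <= dual_norm f + dual_norm g.
Proof.
apply: dual_norm_le => x x1; apply: (le_trans (ler_normD (f x) (g x))).
by apply: lerD; exact: le_dual_norm.
Qed.

Let dual_normZ_le (l : R) (f : dual) :
  dual_norm (l *: f) <= `|l| * dual_norm f.
Proof.
apply: dual_norm_le => x x1; rewrite (_ : dual_fun (l *: f) x = l * f x)//.
by rewrite normrM ler_wpM2l ?le_dual_norm.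
Qed.

Lemma dual_normZ (l : R) (f : dual) : dual_norm (l *: f) = `|l| * dual_norm f.
Proof.
apply/eqP; rewrite eq_le dual_normZ_le/=; have [->|l0] := eqVneq l 0.
  by rewrite normr0 mul0r dual_norm_ge0.
rewrite -ler_pdivlMl ?normr_gt0// -normfV.
by apply: le_trans (dual_normZ_le _ _); rewrite scalerA mulVf// scale1r.
Qed.

Lemma dual_norm_eq0 (f : dual) : dual_norm f = 0 -> f = 0.
Proof.
move=> f0; apply/val_inj/funext => x; change (f x = 0).
have [lf _] : linear f /\ continuous f by have := valP f; rewrite inE.
have fZ a y : f (a *: y) = a * f y.
  have h0 : f 0 = 0 by apply: (addIr (f 0)); rewrite -{1}[f 0]scale1r -lf
    scaler0 addr0 add0r.
  by rewrite -[a *: y]addr0 lf h0 addr0.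
have [->|x0] := eqVneq x 0; first by rewrite -(scale0r 0) fZ mul0r.
have := @le_dual_norm f (`|x|^-1 *: x).
rewrite normrZ normfV normr_id mulVf ?normr_eq0// f0 => /(_ (lexx _)).
rewrite normr_le0 fZ mulf_eq0 invr_eq0 normr_eq0 (negbTE x0) /=.
by move/eqP.
Qed.

HB.instance Definition _ := Lmodule_isNormed.Build R dual
  dual_normD dual_normZ dual_norm_eq0.

End Dual.

Definition reflexive_space (R : realType) (X : normedModType R) : Prop :=
  forall F : dual (dual X), exists x : X, forall f : dual X, F f = f x.

Definition schauder_basis (R : realType) (X : normedModType R) (e : nat -> X) :=
  forall x : X, exists! a : nat -> R, series (fun n => a n *: e n) @ \oo --> x.

(* Finitely supported sequences are those supported in {0, ..., N - 1} for
   some N. *)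
Definition one_symmetric (R : realType) (X : normedModType R) (e : nat -> X) :=
  forall (N : nat) (a : nat -> R) (eps : nat -> R) (p : nat -> nat),
    (forall n, eps n = 1 \/ eps n = -1) -> bijective p ->
    `|\sum_(n < N) (eps n * a n) *: e (p n)| = `|\sum_(n < N) a n *: e n|.

Section Ell1.
Context (R : realType).

Definition ell1_pred : {pred nat -> R^o} :=
  mem [set a : nat -> R^o | (\sum_(n <oo) `|a n|%:E < +oo)%E].

Lemma ell1_submod_closed : submod_closed ell1_pred.
Proof.
split=> [|l a b].
  by rewrite inE /= eseries0 ?ltry// => n _ _ /=; rewrite normr0.
rewrite !inE /= => aoo boo.
apply: (@le_lt_trans _ _
  (\sum_(n <oo) (`|l|%:E * `|a n|%:E + `|b n|%:E)))%E.
  apply: lee_nneseries => [n _ _|n _]; first by rewrite lee_fin.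
  by rewrite -EFinM -EFinD lee_fin (le_trans (ler_normD _ _))// normrM.
rewrite nneseriesD => [|n _ _|n _ _]; rewrite -?EFinM ?lee_fin ?mulr_ge0//.
rewrite nneseriesZl => [|n _]; rewrite ?lee_fin//.
by rewrite lte_add_pinfty// lte_mul_pinfty// lee_fin.
Qed.

HB.instance Definition _ := GRing.isSubmodClosed.Build _ _ ell1_pred
  ell1_submod_closed.

Definition ell1 := {a : nat -> R^o | a \in ell1_pred}.
HB.instance Definition _ := SubType.on ell1.
HB.instance Definition _ := Choice.on ell1.
HB.instance Definition _ := [SubChoice_isSubLmodule of ell1 by <:].

Definition ell1_norm (a : ell1) : R := fine (\sum_(n <oo) `|val a n|%:E)%E.

Lemma ell1_normE (a : ell1) :
  ((ell1_norm a)%:E = \sum_(n <oo) `|val a n|%:E)%E.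
Proof.
rewrite fineK// ge0_fin_numE; last exact: nneseries_ge0.
by case: a => a /=; rewrite inE.
Qed.

Lemma ell1_normD (a b : ell1) : ell1_norm (a + b) <= ell1_norm a + ell1_norm b.
Proof.
rewrite -lee_fin EFinD !ell1_normE -nneseriesD => [|n _ _|n _ _]//.
apply: lee_nneseries => [n _ _|n _]; first by rewrite lee_fin.
by rewrite -EFinD lee_fin; exact: ler_normD.
Qed.

Lemma ell1_normZ (l : R) (a : ell1) : ell1_norm (l *: a) = `|l| * ell1_norm a.
Proof.
apply: EFin_inj; rewrite EFinM !ell1_normE -nneseriesZl => [|n _]//.
by apply: eq_eseriesr => n _; rewrite -EFinM -normrM.
Qed.

Lemma ell1_norm_eq0 (a : ell1) : ell1_norm a = 0 -> a = 0.
Proof.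
move=> a0; apply/val_inj/funext => n; change (val a n = 0).
apply/eqP; rewrite -normr_le0 -lee_fin -[leRHS](congr1 EFin a0) ell1_normE.
rewrite (nneseriesD1 (n := n))//.
by rewrite leeDl// nneseries_ge0.
Qed.

HB.instance Definition _ := Lmodule_isNormed.Build R ell1
  ell1_normD ell1_normZ ell1_norm_eq0.

End Ell1.

(* T is an isomorphism of E onto the subspace T(E) of Y. *)
Definition contains_copy (R : realType) (E Y : normedModType R) : Prop :=
  exists (T : {linear E -> Y}) (c C : R), 0 < c /\
    forall x : E, c * `|x| <= `|T x| <= C * `|x|.

(* The ambient space is R^(d+1): Lebesgue measure is the Caratheodory measure of
   the outer measure given by countable covers by open boxes, degenerate (hence
   empty) boxes being allowed in the covers. *)
Section Lebesgue.
Context (R : realType) (d : nat).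
Local Notation Rd := 'rV[R]_d.+1.

Definition parallelepiped (a b : Rd) : set Rd :=
  [set x | forall i, a 0 i < x 0 i < b 0 i].

Definition box_volume (a b : Rd) : R := \prod_i (b 0 i - a 0 i).

Definition box_cover (A : set Rd) : set (nat -> Rd * Rd) :=
  [set F : nat -> Rd * Rd | (forall k i, (F k).1 0 i <= (F k).2 0 i) /\
           A `<=` \bigcup_k parallelepiped (F k).1 (F k).2].

Local Open Scope ereal_scope.

Definition lebesgue_outer (A : set Rd) : \bar R :=
  ereal_inf [set \sum_(k <oo) (box_volume (F k).1 (F k).2)%:E
            | F in box_cover A].

Let box_volume_ge0 (a b : Rd) : (forall i, a 0 i <= b 0 i)%R ->
  0 <= (box_volume a b)%:E.
Proof. by move=> ab; rewrite lee_fin prodr_ge0// => i _; rewrite subr_ge0. Qed.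

Lemma lebesgue_outer_ge0 A : 0 <= lebesgue_outer A.
Proof.
apply: le_ereal_inf_tmp => _ [F [F0 _] <-].
by apply: nneseries_ge0 => k _ _; exact: box_volume_ge0.
Qed.

Lemma lebesgue_outer0 : lebesgue_outer set0 = 0.
Proof.
apply/eqP; rewrite eq_le lebesgue_outer_ge0 andbT.
apply: ereal_inf_lbound; exists (fun=> (0, 0)%R); first by split.
apply: eseries0 => k _ _; congr EFin.
by rewrite /box_volume big_ord_recl !mxE subrr mul0r.
Qed.

Lemma le_lebesgue_outer : {homo lebesgue_outer : A B / A `<=` B >-> A <= B}.
Proof.
move=> A B AB; apply/ereal_inf_le_tmp => _ [F [F0 BF] <-].
by exists F => //; split=> //; exact: subset_trans BF.
Qed.

Lemma lebesgue_outer_sigma_subadditive : sigma_subadditive lebesgue_outer.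
Proof.
move=> A; have [[i ioo]|] := pselect (exists i, lebesgue_outer (A i) = +oo).
  rewrite (eseries_pinfty _ _ ioo) ?leey// => n _.
  by rewrite -ltNye (lt_le_trans _ (lebesgue_outer_ge0 _)).
rewrite -forallNE => Aoo.
suff add2e (e : {posnum R}) : lebesgue_outer (\bigcup_n A n) <=
    \sum_(i <oo) lebesgue_outer (A i) + e%:num%:E.
  by apply/lee_addgt0Pr => _/posnumP[].
rewrite (le_trans _ (epsilon_trick _ _ _))//; last first.
  by move=> n; exact: lebesgue_outer_ge0.
pose vol (p : Rd * Rd) := (box_volume p.1 p.2)%:E.
pose P n (F : nat -> Rd * Rd) := box_cover (A n) F /\
  \sum_(k <oo) vol (F k) <= lebesgue_outer (A n) + (e%:num / (2 ^ n.+1)%:R)%:E.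
have [G PG] : {G : nat -> nat -> Rd * Rd & forall n, P n (G n)}.
  apply: (@choice _ _ P) => n.
  have en1 : (0 < e%:num / (2 ^ n.+1)%:R :> R)%R by [].
  have fn : lebesgue_outer (A n) \is a fin_num.
    by rewrite ge0_fin_numE ?lebesgue_outer_ge0// ltey; exact/eqP/Aoo.
  have [_ [F AF <-] Fe] := lb_ereal_inf_adherent en1 fn.
  by exists F; split=> //; exact: ltW.
have volG_ge0 x : 0 <= (vol \o uncurry G) x.
  by case: x => n k; apply: box_volume_ge0; exact: (PG n).1.1.
apply: (@le_trans _ _ (\esum_(i in setT) (vol \o uncurry G) i)).
  apply: ereal_inf_lbound => /=.
  have /card_esym/ppcard_eqP[f] := card_nat2.
  exists (uncurry G \o f).
    split=> [k|t [n _ /(PG n).1.2[k _ Gt]]].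
      by rewrite /=; case: (f k) => n m; exact: (PG n).1.1.
    by exists (f^-1%FUN (n, k)) => //=; rewrite invK ?inE.
  rewrite -(esum_pred_image (vol \o uncurry G) _ xpredT) ?[fun=> _]set_true//.
  by rewrite image_eq.
rewrite (_ : esum _ _ = \sum_(i <oo) \sum_(j <oo) vol (G i j)); last first.
  pose J : nat -> set (nat * nat) := fun i => [set (i, j) | j in setT].
  rewrite (_ : setT = \bigcup_k J k); last first.
    by rewrite predeqE => -[a b]; split => // _; exists a => //; exists b.
  rewrite esum_bigcupT /=; last 2 first.
  - apply/trivIsetP => i j _ _ ij.
    rewrite predeqE => -[n m] /=; split => //= -[] [_] _ [<-{n} _].
    by move=> [m' _] [] /esym/eqP; rewrite (negbTE ij).
  - by move=> x; exact: volG_ge0.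
  rewrite -(image_id [set: nat]) -fun_true esum_pred_image//; last first.
    by move=> n _; apply: esum_ge0 => x _; exact: volG_ge0.
  apply: eq_eseriesr => /= j _.
  rewrite -(esum_pred_image (vol \o uncurry G) (pair j) predT)//=; last first.
    by move=> ? ? _ _; exact: (@can_inj _ _ _ snd).
    by move=> n _; exact: (volG_ge0 (j, n)).
  by congr esum; rewrite predeqE => -[a b]; split; move=> [i _ <-]; exists i.
apply: lee_nneseries => [n _ _|n _]; last exact: (PG n).2.
by apply: nneseries_ge0 => m _ _; exact: (volG_ge0 (n, m)).
Qed.

HB.instance Definition _ := isOuterMeasure.Build R Rd lebesgue_outer
  lebesgue_outer0 lebesgue_outer_ge0 le_lebesgue_outer
  lebesgue_outer_sigma_subadditive.

(* R^(d+1) with its Lebesgue (that is, Caratheodory-measurable) sets. *)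
Definition lebesgue_space := caratheodory_type lebesgue_outer.
HB.instance Definition _ := Measurable.on lebesgue_space.

Definition lebesgue : set lebesgue_space -> \bar R := lebesgue_outer.
HB.instance Definition _ := isMeasure.Build _ lebesgue_space R lebesgue
  (@caratheodory_measure0 _ _ lebesgue_outer)
  (@caratheodory_measure_ge0 _ _ lebesgue_outer)
  (@caratheodory_measure_sigma_additive _ _ lebesgue_outer).

End Lebesgue.

Section JF.
Context (R : realType) (d : nat) (X : completeNormedModType R) (e : nat -> X).
Local Notation Rd := (lebesgue_space R d).

Definition parallelepipeds (Omega : set 'rV[R]_d.+1) : set (set 'rV[R]_d.+1) :=
  [set T | T `<=` Omega /\
           exists a b : 'rV[R]_d.+1,
             (forall i, a 0 i < b 0 i) /\ T = parallelepiped a b].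

Definition L1 (Omega : set Rd) : set (Rd -> R) :=
  [set f | (@lebesgue R d).-integrable Omega (EFin \o f)].

(* The supremum is taken in the extended reals, so that no finiteness is built
   into the definition. *)
Definition JF_norm (Omega : set Rd) (f : Rd -> R) : \bar R :=
  ereal_sup [set z | exists (m : nat) (T : nat -> set Rd),
    [/\ forall j, (j < m)%N -> parallelepipeds Omega (T j),
        trivIset `I_m T &
        z = `|\sum_(j < m) (\int[@lebesgue R d]_(x in T j) f x) *: e j|%:E]].

(* (J, iota) is a completion of L^1(Omega) for the JF norm. The map iota is
   defined on functions rather than on classes for equality almost everywhere:
   it identifies f and g as soon as JF_norm Omega (f - g) = 0. Its values at
   functions which are not integrable on Omega play no role. *)
Definition is_JF (Omega : set Rd) (J : completeNormedModType R)
    (iota : (Rd -> R) -> J) : Prop :=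
  [/\ forall (l : R) (f g : Rd -> R), L1 Omega f -> L1 Omega g ->
        iota (fun x => l * f x + g x) = l *: iota f + iota g,
      forall f, L1 Omega f -> `|iota f|%:E = JF_norm Omega f &
      dense (iota @` L1 Omega)].

End JF.

(* Main.v *)
(* An l1-sequence of JF may be perturbed into L^1. By a Helly type selection
   (JF-bounded functions have few disjoint boxes with large integral, because
   |e_0 + ... + e_n| is unbounded), successive differences g_k of a subsequence
   satisfy int_T g_k -> 0 for every box T, while their convex combinations stay
   bounded away from 0 in norm. The norm is the supremum of the functionals
   sum_j b_j int_{T_j}, with (b_j) in the unit ball of X* arranged in decreasing
   order and the T_j disjoint boxes. Since X is not l1, the b_j tend to 0
   uniformly, so this set of functionals is closed under pointwise limits on
   L^1; since the basis of X is shrinking, the g_k tend to 0 pointwise on it.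
   Simons' inequality then produces convex combinations of the g_k of small
   norm, a contradiction. *)

Require Import Defs.
From HB Require Import structures.
From mathcomp Require Import all_boot all_order all_algebra.
From mathcomp Require Import all_classical all_reals all_analysis.
From mathcomp Require Import lra.
Set Implicit Arguments.
Unset Strict Implicit.
Unset Printing Implicit Defensive.
Import Order.TTheory GRing.Theory Num.Theory.
Import numFieldNormedType.Exports.
Local Open Scope classical_set_scope.
Local Open Scope ring_scope.

(** * Symmetric bases *)

(** The obstacle is that only the James norms of the [g k] are bounded uniformly; their L^1 norms
    may grow with k. Whatever must hold for all large k therefore has to come from the shrinking
    property and the James norm bound. The L^1 norm is used only after k is fixed: there absolute
    continuity makes a box integral depend continuously on the corners, and integrability bounds
    sums over disjoint boxes. Limits are taken along free ultrafilters, so all coefficients and all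
    corners of a sequence of test systems converge at once, and reflexivity enters as the existence
    of weak limits of bounded families. The dual ball is described by inequalities on finite sums, a
    form stable under coordinatewise limits and under rearrangement. Simons' inequality is used in a
    form that assumes no maximiser: it gives almost maximising test systems y_N such that, for each
    n, some [h k] with n <= k < B is at least c / 4 at y_N for all large N, where B does not depend
    on N. The limit of the y_N along an ultrafilter then contradicts pointwise convergence to 0. *)

Lemma extend_uniq_seq (s : seq nat) : uniq s ->
  exists2 p : nat -> nat, bijective p &
    forall i, (i < size s)%N -> p i = nth 0%N s i.
Proof.
move=> us; have [M sM] : exists M, forall i, i \in s -> (i < M)%N.
  by exists (\max_(i <- s) i).+1 => i si; rewrite ltnS leq_bigmax_seq.
(* The permutation lists [s], then the other indices below [M], and fixes every index from [M]
   on. *)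
pose t := s ++ [seq i <- iota 0 M | i \notin s].
have ut : uniq t.
  rewrite cat_uniq us filter_uniq ?iota_uniq// andbT.
  by apply/hasPn => i; rewrite mem_filter => /andP[].
have tE : t =i iota 0 M.
  move=> i; rewrite mem_cat mem_filter mem_iota add0n .
  by have [/sM|] := boolP (i \in s).
have sz : size t = M by rewrite (perm_size (uniq_perm ut (iota_uniq _ _) tE)) size_iota.
exists (fun i => if (i < M)%N then nth 0%N t i else i).
  exists (fun j => if (j < M)%N then index j t else j) => i /=.
    case: (ltnP i M) => iM; last by rewrite ltnNge iM.
    have : nth 0%N t i \in iota 0 M by rewrite -tE mem_nth// sz.
    by rewrite mem_iota add0n /= => ->; rewrite index_uniq// sz.
  case: (ltnP i M) => iM; last by rewrite ltnNge iM.
  have it : i \in t by rewrite tE mem_iota.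
  by rewrite -{1}sz index_mem it nth_index.
move=> i si.
have iM : (i < M)%N by rewrite -sz size_cat ltn_addr.
by rewrite iM nth_cat si.
Qed.

Section SymmetricBasis.
Context (R : realType) (X : completeNormedModType R) (e : nat -> X).
Hypotheses (e_basis : schauder_basis e) (e_symmetric : one_symmetric e).

Lemma norm_sum_uniq_seq (s : seq nat) (x : nat -> R) : uniq s ->
  `|\sum_(i < size s) x i *: e (nth 0%N s i)| = `|\sum_(i < size s) x i *: e i|.
Proof.
move=> /extend_uniq_seq[p bp ps].
rewrite -(e_symmetric (size s) x (fun _ => or_introl erefl) bp).
by congr `|_|; apply: eq_bigr => i _; rewrite mul1r ps.
Qed.

Lemma norm_sum_sign (N : nat) (x eps : nat -> R) :
  (forall n, eps n = 1 \/ eps n = -1) ->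
  `|\sum_(i < N) (eps i * x i) *: e i| = `|\sum_(i < N) x i *: e i|.
Proof. by move=> eP; apply: (@e_symmetric N x eps id) => //; exists id. Qed.

(** The restriction to [P] is the average of the vector and of its image under the sign change off
    [P], which has the same norm. *)
Lemma norm_sum_restrict (P : pred nat) (N : nat) (x : nat -> R) :
  `|\sum_(i < N) (if P i then x i else 0) *: e i| <= `|\sum_(i < N) x i *: e i|.
Proof.
pose eps i : R := if P i then 1 else -1.
have eP n : eps n = 1 \/ eps n = -1 by rewrite /eps; case: (P n); [left|right].
have -> : \sum_(i < N) (if P i then x i else 0) *: e i = 2^-1 *:
    (\sum_(i < N) x i *: e i + \sum_(i < N) (eps i * x i) *: e i).
  rewrite -big_split scaler_sumr; apply: eq_bigr => i _ /=.
  rewrite -scalerDl scalerA /eps; congr (_ *: _).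
  by case: (P i); lra.
rewrite normrZ (le_trans (ler_wpM2l (normr_ge0 _) (ler_normD _ _)))//.
rewrite norm_sum_sign// normfV ger0_norm//; lra.
Qed.

Lemma norm_basis (n : nat) : `|e n| = `|e 0|.
Proof.
have := @norm_sum_uniq_seq [:: n] (fun=> 1) erefl.
by rewrite !big_ord_recl !big_ord0 /= !addr0 !scale1r.
Qed.

(** If one basis vector vanished, all would, and every coefficient sequence would expand 0, against
    uniqueness. *)
Lemma norm_basis_gt0 (n : nat) : 0 < `|e n|.
Proof.
rewrite norm_basis normr_gt0; apply/eqP => e0.
have en i : e i = 0 by apply/eqP; rewrite -normr_eq0 norm_basis e0 normr0.
have [a [aP a_uniq]] := e_basis 0.
have c0 b : series (fun n => b n *: e n) @ \oo --> (0 : X).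
  rewrite [X in X @ _](_ : _ = cst 0); first exact: cvg_cst.
  apply/funext => k; rewrite /series /= big1// => i _.
  by rewrite en scaler0.
have := a_uniq _ (c0 (fun n => a n + 1)).
by move/(congr1 (fun f => f 0%N)) => /=; lra.
Qed.

Lemma ler_norm_coord (N : nat) (x : nat -> R) (k : nat) : (k < N)%N ->
  `|x k| * `|e 0| <= `|\sum_(i < N) x i *: e i|.
Proof.
move=> kN; rewrite (le_trans _ (norm_sum_restrict (pred1 k) N x))//.
rewrite (bigD1 (Ordinal kN)) //= eqxx big1 ?addr0 ?normrZ ?norm_basis//.
by move=> i ik; rewrite ifF ?scale0r//; apply: contraNF ik => /eqP ik; apply/eqP/val_inj.
Qed.

Lemma norm_sum_scale1 (N : nat) (x y : nat -> R) (k : nat) :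
  (forall i, i != k -> y i = x i) -> `|y k| <= `|x k| ->
  `|\sum_(i < N) y i *: e i| <= `|\sum_(i < N) x i *: e i|.
Proof.
move=> yx ykx.
have [xk0|xk0] := eqVneq (x k) 0.
  have yx' : y = x.
    apply/funext => i; have [->|] := eqVneq i k; last exact: yx.
    by move: ykx; rewrite xk0 normr0 normr_le0 => /eqP.
  by rewrite yx'.
have [t tE] : exists t, t = y k / x k by exists (y k / x k).
have yk : y k = t * x k by rewrite tE divfK.
have t1 : `|t| <= 1 by rewrite tE normrM normfV ler_pdivrMr ?mul1r ?normr_gt0.
pose eps i : R := if i == k then -1 else 1.
have eP n : eps n = 1 \/ eps n = -1 by rewrite /eps; case: (n == k); [right|left].
(* With t in [-1, 1], the new vector is a convex combination of the old one and of its reflection in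
   coordinate [k]. *)
have -> : \sum_(i < N) y i *: e i = ((1 + t) / 2) *: (\sum_(i < N) x i *: e i)
   + ((1 - t) / 2) *: (\sum_(i < N) (eps i * x i) *: e i).
  rewrite !scaler_sumr -big_split; apply: eq_bigr => i _ /=.
  rewrite !scalerA -scalerDl; congr (_ *: _); rewrite /eps.
  have [ik|ik] := eqVneq (i : nat) k.
    by rewrite ik yk; lra.
  by rewrite yx//; lra.
move: t1; rewrite ler_norml => /andP[t1 t2].
rewrite (le_trans (ler_normD _ _))// !(normrZ (_ / _)) norm_sum_sign//.
rewrite -mulrDl (ger0_norm (_ : 0 <= (1 + t) / 2)) ?(ger0_norm (_ : 0 <= (1 - t) / 2)); [|lra|lra].
by rewrite (_ : (1 + t) / 2 + (1 - t) / 2 = 1) ?mul1r//; lra.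
Qed.

Lemma ler_norm_basis_sum (N : nat) (x y : nat -> R) :
  (forall i, (i < N)%N -> `|y i| <= `|x i|) ->
  `|\sum_(i < N) y i *: e i| <= `|\sum_(i < N) x i *: e i|.
Proof.
move=> yx.
(* The coordinates of [x] are replaced by those of [y] one at a time. *)
suff H k : (k <= N)%N ->
    `|\sum_(i < N) (if (i < k)%N then y i else x i) *: e i| <= `|\sum_(i < N) x i *: e i|.
  apply: le_trans (H N (leqnn N)).
  by rewrite le_eqVlt; apply/orP; left; apply/eqP; congr `|_|; apply: eq_bigr => i _; rewrite ltn_ord.
elim: k => [_|k IH kN]; first by [].
apply: le_trans (IH (ltnW kN)).
apply: (@norm_sum_scale1 N (fun i => if (i < k)%N then y i else x i)
   (fun i => if (i < k.+1)%N then y i else x i) k).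
  by move=> i ik; rewrite ltnS leq_eqVlt (negbTE ik).
by rewrite /= ltnS leqnn ltnn; exact: yx.
Qed.

Lemma norm_sum_compress (N : nat) (x : nat -> R) :
  let s := [seq i <- iota 0 N | x i != 0] in
  `|\sum_(i < N) x i *: e i| = `|\sum_(i < size s) x (nth 0%N s i) *: e i|.
Proof.
move=> s; have us : uniq s by rewrite filter_uniq ?iota_uniq.
rewrite -(norm_sum_uniq_seq (fun i => x (nth 0%N s i)) us); congr `|_|.
rewrite -(big_mkord xpredT (fun i => x i *: e i)).
rewrite -(big_mkord xpredT (fun i => x (nth 0%N s i) *: e (nth 0%N s i))).
rewrite -(big_nth 0%N xpredT (fun i => x i *: e i)) /s big_filter.
rewrite [RHS]big_mkcond /= /index_iota subn0.
by apply: eq_bigr => i _; case: eqVneq => // ->; rewrite scale0r.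
Qed.

End SymmetricBasis.

(** * Reflexivity and the dual unit ball *)

Lemma cvg_le (R : realType) (T : Type) (U : set_system T)
    (PU : ProperFilter U) (u : T -> R) (l C : R) :
  u x @[x --> U] --> l -> (\forall x \near U, u x <= C) -> l <= C.
Proof.
move=> ul uC; rewrite leNgt; apply/negP => Cl.
have [x []] := filter_ex (filterI uC (cvgr_gt _ ul _ Cl)).
by move=> /le_lt_trans /[apply]; rewrite ltxx.
Qed.

Lemma cvg_ge (R : realType) (T : Type) (U : set_system T)
    (PU : ProperFilter U) (u : T -> R) (l C : R) :
  u x @[x --> U] --> l -> (\forall x \near U, C <= u x) -> C <= l.
Proof.
move=> ul uC; rewrite leNgt; apply/negP => Cl.
have [x []] := filter_ex (filterI uC (cvgr_lt _ ul _ Cl)).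
by move=> /le_lt_trans /[apply]; rewrite ltxx.
Qed.

Lemma ultra_fmap (T V : Type) (f : T -> V) (U : set_system T) :
  UltraFilter U -> UltraFilter (f @ U).
Proof.
move=> UU; split=> [|G GF fUG]; first exact: fmap_proper_filter.
apply/seteqP; split=> A; last exact: fUG.
move=> GA; have [//|UnA] := in_ultra_setVsetC (f @^-1` A) UU.
have : G (A `&` ~` A) by apply: filterI => //; exact: fUG.
by rewrite setICr => /filter_not_empty.
Qed.

Lemma ultra_bounded_cvg (R : realType) (T : Type) (U : set_system T)
    (UU : UltraFilter U) (u : T -> R) (C : R) :
  (forall t, `|u t| <= C) -> exists l : R, u x @[x --> U] --> l.
Proof.
move=> uC; have := @segment_compact R (- C) C; rewrite compact_ultra.
have UI : UltraFilter (u x @[x --> U]) by exact: ultra_fmap.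
move=> /(_ _ UI)[].
  apply: (@filterS _ U _ setT) => [t _|]; last exact: filterT.
  by rewrite /= in_itv /= -ler_norml.
by move=> l [_ ul]; exists l.
Qed.

Lemma sum_nat_if (V : nmodType) (m n : nat) (F : nat -> V) :
  \sum_(m <= k < n) F k = \sum_(i < n) (if (m <= i)%N then F i else 0).
Proof. by rewrite (big_nat_widenl m 0)// big_mkord big_mkcond. Qed.

Lemma sum_if_swap (V : nmodType) (N M : nat) (F : nat -> V) :
  \sum_(i < N) (if (i < M)%N then F i else 0) =
  \sum_(i < M) (if (i < N)%N then F i else 0).
Proof.
rewrite -!big_mkcond /=; have [MN|/ltnW NM] := leqP M N.
  by rewrite -(big_ord_widen _ F MN); apply: eq_bigl => i; rewrite (leq_trans _ MN).
by rewrite -(big_ord_widen _ F NM); apply: eq_bigl => i; rewrite (leq_trans _ NM).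
Qed.

Lemma free_ultrafilter : exists U : set_system nat, UltraFilter U /\ \oo `<=` U.
Proof. exact: ultraFilterLemma. Qed.

Lemma dual_linear (R : realType) (X : normedModType R) (f : dual X) :
  linear f /\ continuous f.
Proof. by have := valP f; rewrite inE. Qed.

Lemma dual_sum (R : realType) (X : normedModType R) (f : dual X)
    (N : nat) (x : nat -> R) (u : nat -> X) :
  f (\sum_(i < N) x i *: u i) = \sum_(i < N) x i * f (u i).
Proof.
have [lf _] := dual_linear f.
have f0 : f 0 = 0.
  by have := lf 1 0 0; rewrite scaler0 addr0 scale1r => /eqP;
    rewrite -subr_eq0 opprD addrA subrr sub0r oppr_eq0 => /eqP.
elim: N => [|N IH]; first by rewrite !big_ord0.
by rewrite !big_ord_recr /= addrC lf IH addrC.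
Qed.

Lemma dual_le (R : realType) (X : normedModType R) (f : dual X) (x : X) :
  `|f x| <= dual_norm f * `|x|.
Proof.
have [x0|x0] := eqVneq x 0.
  have := @dual_sum _ _ f 0 (fun=> 0) (fun=> 0); rewrite !big_ord0 x0 => ->.
  by rewrite !normr0 mulr0.
have := @le_dual_norm _ _ f (`|x|^-1 *: x).
rewrite normrZ normfV normr_id mulVf ?normr_eq0// => /(_ (lexx _)).
have := @dual_sum _ _ f 1 (fun=> `|x|^-1) (fun=> x).
rewrite !big_ord_recl !big_ord0 !addr0 => ->.
by rewrite normrM normfV normr_id ler_pdivrMl ?normr_gt0// mulrC.
Qed.

Lemma mk_dual (R : realType) (X : normedModType R) (f : X -> R) (C : R) :
  linear (f : X -> R^o) -> (forall x, `|f x| <= C * `|x|) ->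
  exists g : dual X, forall x, g x = f x.
Proof.
move=> lf fC.
pose Lf := GRing.isLinear.Build _ _ _ _ (f : X -> R^o) lf.
pose fL : {linear X -> R^o} := HB.pack (f : X -> R^o) Lf.
have cf : continuous (f : X -> R^o).
  apply: (@bounded_linear_continuous _ _ _ fL).
  apply/linear_boundedP; exists C; split; first exact: num_real.
  move=> r Cr x; rewrite (le_trans (fC x))// ler_wpM2r//; exact: ltW.
have fP : (f : X -> R^o) \in @dual_pred R X by rewrite inE.
by exists (exist (fun g => g \in @dual_pred R X) _ fP).
Qed.

(** The limits of [f (u t)] along U define a functional of f bounded by [C], hence an element of the
    bidual, which reflexivity represents by a point. *)
Lemma reflexive_weak_limit (R : realType) (X : normedModType R)
    (T : Type) (U : set_system T) (UU : UltraFilter U) (u : T -> X) (C : R) :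
  reflexive_space X -> (forall t, `|u t| <= C) ->
  exists x : X, forall f : dual X, f (u t) @[t --> U] --> f x.
Proof.
move=> Xr uC.
have fu (f : dual X) : exists l : R, f (u t) @[t --> U] --> l.
  apply: (@ultra_bounded_cvg _ _ _ _ _ (dual_norm f * C)) => t.
  by rewrite (le_trans (dual_le f _))// ler_wpM2l ?dual_norm_ge0.
have [F FP] := choice fu.
have lF : linear (F : dual X -> R^o).
  move=> a f g; apply: (cvg_unique _ (FP _)) => //.
  apply: cvgD; last exact: FP.
  by apply: cvgZr; exact: FP.
have FC f : `|F f| <= C * `|f|.
  have FN : (`|f (u t)| : R) @[t --> U] --> (`|F f| : R) by exact: cvg_norm (FP f).
  apply: (@cvg_le R T U _ _ _ _ FN); apply: nearW => t; rewrite mulrC (le_trans (dual_le f _))//.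
  by rewrite ler_wpM2l ?dual_norm_ge0.
have [G GF] := mk_dual lF FC.
have [x xP] := Xr G.
by exists x => f; rewrite -xP GF; exact: FP.
Qed.

(* The sequences bstar are the coefficient sequences of the elements of the
   unit ball of the dual of X. *)
Definition bstar (R : realType) (X : normedModType R) (e : nat -> X)
    (b : nat -> R) :=
  forall N (x : nat -> R), \sum_(i < N) b i * x i <= `|\sum_(i < N) x i *: e i|.

Section Bstar.
Context (R : realType) (X : completeNormedModType R) (e : nat -> X).
Hypotheses (e_basis : schauder_basis e) (e_symmetric : one_symmetric e).

Lemma bstar_abs b (N : nat) (x : nat -> R) : bstar e b ->
  `|\sum_(i < N) b i * x i| <= `|\sum_(i < N) x i *: e i|.
Proof.
move=> bP; rewrite ler_norml bP andbT lerNl -sumrN.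
rewrite -normrN -sumrN; have := bP N (fun i => - x i).
rewrite (eq_bigr (fun i : 'I_N => - (b i * x i))) => [|i _]; last by rewrite mulrN.
by rewrite (eq_bigr (fun i : 'I_N => - (x i *: e i))) => // i _; rewrite scaleNr.
Qed.

Lemma bstar_coord k : bstar e (fun i => if i == k then `|e 0| else 0).
Proof.
move=> N x; have [kN|kN] := ltnP k N; last first.
  rewrite big1 ?normr_ge0// => i _; rewrite ifF ?mul0r//; apply/eqP => ik.
  by have := ltn_ord i; rewrite ik ltnNge kN.
rewrite (bigD1 (Ordinal kN)) //= eqxx big1 ?addr0 => [|i /eqP ik]; last first.
  by rewrite ifF ?mul0r//; apply/eqP => ik'; apply/ik/val_inj.
rewrite mulrC (le_trans _ (ler_norm_coord e_symmetric x kN))//.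
by rewrite ler_wpM2r// ler_norm.
Qed.

Lemma bstar_sign b eps : (forall n, eps n = 1 \/ eps n = -1) ->
  bstar e b -> bstar e (fun i => eps i * b i).
Proof.
move=> eP bP N x; rewrite -(norm_sum_sign e_symmetric N x eP).
apply: le_trans (bP N (fun i => eps i * x i)).
by rewrite le_eqVlt; apply/orP; left; apply/eqP/eq_bigr => i _; lra.
Qed.

Lemma bstar_norm b : bstar e b -> bstar e (fun i => `|b i|).
Proof.
move=> bP; pose eps i : R := if 0 <= b i then 1 else -1.
have -> : (fun i => `|b i|) = (fun i => eps i * b i).
  apply/funext => i; rewrite /eps; case: (lerP 0 (b i)) => bi.
    by rewrite ger0_norm// mul1r.
  by rewrite ltr0_norm// mulN1r.
by apply: bstar_sign bP => i; rewrite /eps; case: ifP; [left|right].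
Qed.

(** Pairing the rearranged sequence with [x] amounts to pairing [b] with the vector carrying [x i]
    at position [nth 0 s i]; symmetry and restriction bound the norm of that vector. *)
Lemma bstar_uniq_seq b (s : seq nat) : uniq s -> bstar e b ->
  bstar e (fun i => if (i < size s)%N then b (nth 0%N s i) else 0).
Proof.
move=> us bP N x; pose y i := if (i < N)%N then x i else 0.
have [K sK] : exists K, forall i, i \in s -> (i < K)%N.
  by exists (\max_(i <- s) i).+1 => i si; rewrite ltnS leq_bigmax_seq.
have sumK (V : zmodType) (F : nat -> V) :
    \sum_(j < K) (if (j : nat) \in s then F j else 0) = \sum_(i < size s) F (nth 0%N s i).
  rewrite -(big_mkord xpredT (fun j => if j \in s then F j else 0)) -big_mkcond.
  rewrite -(big_mkord xpredT (fun i => F (nth 0%N s i))).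
  rewrite -(big_nth 0%N xpredT F) -big_filter; apply: perm_big.
  apply: uniq_perm => //; first by rewrite filter_uniq// iota_uniq.
  move=> i; rewrite mem_filter /index_iota subn0 mem_iota.
  by have [/sK ->|] := boolP (i \in s).
have -> : \sum_(i < N) (if (i < size s)%N then b (nth 0%N s i) else 0) * x i =
    \sum_(j < K) b j * (if (j : nat) \in s then y (index (j : nat) s) else 0).
  transitivity (\sum_(j < K) (if (j : nat) \in s then b j * y (index (j : nat) s) else 0)).
    rewrite (sumK _ (fun j => b j * y (index j s))).
    transitivity (\sum_(i < N) (if (i < size s)%N then b (nth 0%N s i) * x i else 0)).
      by apply: eq_bigr => i _; case: ifP => // _; rewrite mul0r.
    rewrite (sum_if_swap N _ (fun i => b (nth 0%N s i) * x i)).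
    apply: eq_bigr => i _; rewrite index_uniq// /y.
    by case: ifP; rewrite ?mulr0.
  by apply: eq_bigr => i _; case: ifP; rewrite ?mulr0.
rewrite (le_trans (bP K (fun j => if j \in s then y (index j s) else 0)))//.
have -> : \sum_(i < K) (if (i : nat) \in s then y (index (i : nat) s) else 0) *: e i =
   \sum_(i < size s) y i *: e (nth 0%N s i).
  transitivity (\sum_(i < K) (if (i : nat) \in s then y (index (i : nat) s) *: e i else 0)).
    by apply: eq_bigr => i _; case: ifP; rewrite ?scale0r.
  rewrite (sumK _ (fun i => y (index i s) *: e i)).
  by apply: eq_bigr => i _; rewrite index_uniq.
rewrite norm_sum_uniq_seq//.
rewrite (le_trans _ (norm_sum_restrict e_symmetric (fun i => i < size s)%N N x))//.
rewrite le_eqVlt; apply/orP; left; apply/eqP; congr `|_|.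
transitivity (\sum_(i < N) (if (i < size s)%N then x i *: e i else 0)); last first.
  by apply: eq_bigr => i _; case: ifP; rewrite ?scale0r.
rewrite (sum_if_swap N _ (fun i => x i *: e i)).
by apply: eq_bigr => i _; rewrite /y; case: ifP; rewrite ?scale0r.
Qed.

Lemma bstar_lim (T : Type) (U : set_system T) (PU : ProperFilter U)
    (b : T -> nat -> R) (c : nat -> R) :
  (forall t, bstar e (b t)) -> (forall i, b t i @[t --> U] --> c i) -> bstar e c.
Proof.
move=> bP bc N x.
have : (\sum_(i < N) b t i * x i) @[t --> U] --> \sum_(i < N) c i * x i.
  elim: N => [|N IH].
    under eq_fun do rewrite big_ord0.
    by rewrite big_ord0; exact: cvg_cst.
  under eq_fun do rewrite big_ord_recr.
  rewrite big_ord_recr /=; apply: cvgD; first exact: IH.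
  by apply: cvgMl; exact: bc.
move=> /cvg_le; apply; apply: nearW => t; exact: bP.
Qed.

Lemma bstar_le b i : bstar e b -> `|b i| <= `|e 0|.
Proof.
move=> bP; have := @bstar_abs b i.+1 (fun j => if j == i then 1 else 0) bP.
rewrite !big_ord_recr /= eqxx mulr1 scale1r.
rewrite !big1 ?add0r ?(norm_basis e_symmetric i)// => j _; rewrite ifF ?mulr0 ?scale0r//.
  by apply/eqP => ji; have := ltn_ord j; rewrite ji ltnn.
by apply/eqP => ji; have := ltn_ord j; rewrite ji ltnn.
Qed.

(** Applied to blocks, [bstar_abs] makes the paired series Cauchy as soon as the expansion
    converges; uniqueness of expansions makes its limit a function of the point. *)
Lemma bstar_dual b : bstar e b -> exists f : dual X, forall (a : nat -> R) x,
  series (fun n => a n *: e n) @ \oo --> x ->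
  series (fun n => b n * a n) @ \oo --> f x.
Proof.
move=> bP.
have cv (a : nat -> R) x : series (fun n => a n *: e n) @ \oo --> x ->
    exists l : R, series (fun n => b n * a n) @ \oo --> l /\ `|l| <= `|x|.
  move=> ax.
  have cva : cvg (series (fun n => b n * a n) @ \oo).
    apply/cauchy_cvgP/cauchy_seriesP => eps eps0.
    have /cvg_cauchy/cauchy_seriesP/(_ _ eps0) : cvg (series (fun n => a n *: e n) @ \oo).
      by apply/cvg_ex; exists x.
    apply: filterS => -[m n] /=; apply: le_lt_trans.
    rewrite !sum_nat_if.
    have := @bstar_abs b n (fun i => if (m <= i)%N then a i else 0) bP.
    rewrite (eq_bigr (fun i : 'I_n => if (m <= i)%N then b i * a i else 0)); last first.
      by move=> i _; case: ifP; rewrite ?mulr0.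
    rewrite [in leRHS](eq_bigr (fun i : 'I_n => if (m <= i)%N then a i *: e i else 0))//.
    by move=> i _; case: ifP; rewrite ?scale0r.
  have {}cva : series (fun n => b n * a n) @ \oo --> lim (series (fun n => b n * a n) @ \oo) by [].
  exists (lim (series (fun n => b n * a n) @ \oo)); split=> //.
  apply: (ler_cvg_to (cvg_norm cva) (cvg_norm ax)).
  by apply: nearW => N; rewrite /series /= !big_mkord; exact: bstar_abs.
have /choice[f0 f0P] (x : X) : exists l : R, `|l| <= `|x| /\ forall a, series (fun n => a n *: e n) @ \oo --> x ->
    series (fun n => b n * a n) @ \oo --> l.
  have [a [ax aU]] := e_basis x.
  have [l [al lx]] := cv _ _ ax.
  by exists l; split=> // a' /aU <-.
have lf : linear (f0 : X -> R^o).
  move=> l x y.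
  have [a [ax _]] := e_basis x; have [a' [ay _]] := e_basis y.
  have axy : series (fun n => (l * a n + a' n) *: e n) @ \oo --> l *: x + y.
    have -> : series (fun n => (l * a n + a' n) *: e n) =
       (fun N => l *: series (fun n => a n *: e n) N + series (fun n => a' n *: e n) N).
      apply/funext => N; rewrite /series /= scaler_sumr -big_split.
      by apply: eq_bigr => i _ /=; rewrite scalerDl scalerA.
    by apply: cvgD => //; apply: cvgZr.
  have := (f0P _).2 _ axy.
  have -> : series (fun n => b n * (l * a n + a' n)) =
       (fun N => l *: series (fun n => b n * a n) N + series (fun n => b n * a' n) N).
    apply/funext => N; rewrite /series /= scaler_sumr -big_split.
    by apply: eq_bigr => i _ /=; rewrite /GRing.scale /=; lra.
  move=> /cvg_unique; apply => //.
  apply: cvgD; last exact: (f0P _).2.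
  by apply: cvgZr; exact: (f0P _).2.
have fC x : `|f0 x| <= 1 * `|x| by rewrite mul1r (f0P _).1.
have [f fE] := mk_dual lf fC.
by exists f => a x ax; rewrite fE; exact: (f0P _).2.
Qed.

Lemma series_finite (V : normedModType R) (N : nat) (u : nat -> V) :
  (forall n, (N <= n)%N -> u n = 0) -> series u @ \oo --> \sum_(i < N) u i.
Proof.
move=> u0; apply: cvg_near_cst; exists N => // n /= Nn.
rewrite /series /= (big_cat_nat (leq0n N) Nn) /= big_mkord.
by rewrite [X in _ + X]big_nat_cond [X in _ + X]big1 ?addr0// => i /andP[/andP[/u0]].
Qed.

Lemma bstar_dual_sum b (f : dual X) :
  (forall (a : nat -> R) x, series (fun n => a n *: e n) @ \oo --> x ->
    series (fun n => b n * a n) @ \oo --> f x) ->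
  forall N (x : nat -> R), f (\sum_(i < N) x i *: e i) = \sum_(i < N) b i * x i.
Proof.
move=> fP N x; pose y i := if (i < N)%N then x i else 0.
have xyE (V : zmodType) (F : R -> nat -> V) :
    \sum_(i < N) F (x i) i = \sum_(i < N) F (y i) i.
  by apply: eq_bigr => i _; rewrite /y ltn_ord.
rewrite (xyE _ (fun a i => a *: e i)) (xyE _ (fun a i => b i * a)).
have yN n : (N <= n)%N -> y n = 0 by move=> Nn; rewrite /y ltnNge Nn.
apply: (cvg_unique _ (fP y _ _)) => //.
  by apply: series_finite => n /yN ->; rewrite scale0r.
by apply: (@series_finite R^o N (fun i => b i * y i)) => n /yN ->; rewrite mulr0.
Qed.

Lemma dual_coord k : exists f : dual X, forall (a : nat -> R) x,
  series (fun n => a n *: e n) @ \oo --> x -> f x = `|e 0| * a k.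
Proof.
have [f fP] := bstar_dual (@bstar_coord k); exists f => a x ax.
apply: (cvg_unique _ (fP _ _ ax)) => //.
pose u i := if i == k then `|e 0| * a i else 0.
have -> : (fun n => (if n == k then `|e 0| else 0) * a n) = u.
  by apply/funext => n; rewrite /u; case: ifP; rewrite ?mul0r.
have := @series_finite R^o k.+1 u.
rewrite big_ord_recr /= big1 ?add0r => [|i _]; last first.
  by rewrite /u ifF//; apply/eqP => ik; have := ltn_ord i; rewrite ik ltnn.
rewrite (_ : u k = `|e 0| * a k) ?{1}/u ?eqxx//; apply => n kn; rewrite /u ifF//.
by apply/eqP => nk; rewrite nk ltnn in kn.
Qed.

Lemma dual_coord_sum k (f : dual X) :
  (forall (a : nat -> R) x,
     series (fun n => a n *: e n) @ \oo --> x -> f x = `|e 0| * a k) ->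
  forall N (x : nat -> R), f (\sum_(i < N) x i *: e i) =
    `|e 0| * (if (k < N)%N then x k else 0).
Proof.
move=> fP N x; pose y i := if (i < N)%N then x i else 0.
rewrite (fP y)// (_ : \sum_(i < N) _ = \sum_(i < N) y i *: e i); last first.
  by apply: eq_bigr => i _; rewrite /y ltn_ord.
by apply: series_finite => n Nn; rewrite /y ltnNge Nn scale0r.
Qed.

(** * Shrinking basis and uniform decay of dual coefficients *)

Section Reflexive.
Hypothesis X_reflexive : reflexive_space X.

(** This is the shrinking property. Otherwise there are unit vectors [u m], supported from m on,
    where the functional exceeds [eps]. Their weak limit has all coordinates 0, so the functional
    vanishes there, although its value is a limit of numbers above [eps]. *)
Lemma bstar_tail b (eps : R) : bstar e b -> 0 < eps ->
  exists m, forall N (x : nat -> R), (forall i, (i < m)%N -> x i = 0) ->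
    \sum_(i < N) b i * x i <= eps * `|\sum_(i < N) x i *: e i|.
Proof.
move=> bP eps0; apply: contrapT => H.
have {}H m : exists Nx : nat * (nat -> R), (forall i, (i < m)%N -> Nx.2 i = 0) /\
    eps * `|\sum_(i < Nx.1) Nx.2 i *: e i| < \sum_(i < Nx.1) b i * Nx.2 i.
  apply: contrapT => H'; apply: H; exists m => N x xm; rewrite leNgt.
  by apply/negP => lt; apply: H'; exists (N, x).
have [Nx NxP] := choice H.
pose v m := \sum_(i < (Nx m).1) (Nx m).2 i *: e i.
have v0 m : 0 < `|v m|.
  rewrite normr_gt0; apply/eqP => v0; have := bP (Nx m).1 (Nx m).2.
  have := (NxP m).2; rewrite -/(v m) v0 normr0 mulr0 => /lt_le_trans /[apply].
  by rewrite ltxx.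
pose u m := `|v m|^-1 *: v m.
have [U [UU Uoo]] := free_ultrafilter.
have u1 m : `|u m| <= 1.
  by rewrite /u normrZ normfV normr_id mulVf// gt_eqF.
have [x xP] := reflexive_weak_limit UU X_reflexive u1.
have uE m : u m = \sum_(i < (Nx m).1) (`|v m|^-1 * (Nx m).2 i) *: e i.
  by rewrite /u scaler_sumr; apply: eq_bigr => i _; rewrite scalerA.
have [a [ax _]] := e_basis x.
have a0 k : a k = 0.
  have [f fP] := dual_coord k.
  have : f x = 0.
    apply: (cvg_unique _ (xP f)) => //; apply: cvg_near_cst; apply: Uoo.
    exists k.+1 => // m /= km; rewrite uE (dual_coord_sum fP _ (fun i => `|v m|^-1 * (Nx m).2 i)).
    by case: ifP => _; rewrite ?(NxP m).1 ?mulr0// mulr0.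
  rewrite (fP _ _ ax).
  move/eqP; rewrite mulf_eq0 normr_eq0 -normr_eq0.
  by rewrite gt_eqF ?(norm_basis_gt0 e_basis e_symmetric)//= => /eqP.
have [f fP] := bstar_dual bP.
have : f x = 0.
  apply: (cvg_unique _ (fP _ _ ax)) => //.
  have := @series_finite R^o 0 (fun n => b n * a n); rewrite big_ord0; apply.
  by move=> n _; rewrite a0 mulr0.
have : eps <= f x.
  apply: (@cvg_ge R _ U _ _ _ _ (xP f)); apply: nearW => m.
  rewrite uE (bstar_dual_sum fP _ (fun i => `|v m|^-1 * (Nx m).2 i)).
  rewrite (eq_bigr (fun i : 'I__ => `|v m|^-1 * (b i * (Nx m).2 i))); last first.
    by move=> i _; rewrite mulrCA.
  by rewrite -mulr_sumr ler_pdivlMl// mulrC ltW// (NxP m).2.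
by move=> /[swap] ->; rewrite leNgt eps0.
Qed.

(** Otherwise, moving ever more large coefficients to the front and passing to the limit gives an
    element [d] of the dual ball with all coefficients at least [eps], which [bstar_tail]
    forbids. *)
Lemma bstar_large (eps : R) : 0 < eps -> exists m, forall b, bstar e b ->
  forall s : seq nat, uniq s -> (forall i, i \in s -> eps < `|b i|) -> (size s <= m)%N.
Proof.
move=> eps0; apply: contrapT => H.
have {}H m : exists bs : (nat -> R) * seq nat, [/\ bstar e bs.1, uniq bs.2,
    (forall i, i \in bs.2 -> eps < `|bs.1 i|) & (m < size bs.2)%N].
  apply: contrapT => H'; apply: H; exists m => b bP s us sb; rewrite leqNgt.
  by apply/negP => lt; apply: H'; exists (b, s).
have [bs bsP] := choice H.
pose c m i : R := if (i < size (bs m).2)%N then `|(bs m).1 (nth 0%N (bs m).2 i)| else 0.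
have cP m : bstar e (c m).
  have [bm us _ _] := bsP m.
  exact: (bstar_uniq_seq us (bstar_norm bm)).
have [U [UU Uoo]] := free_ultrafilter.
have /choice[d dP] i : exists l : R, c m i @[m --> U] --> l.
  by apply: (ultra_bounded_cvg UU) => m; exact: bstar_le.
have dstar : bstar e d by apply: bstar_lim cP dP.
have dge i : eps <= d i.
  apply: (@cvg_ge R _ U _ _ _ _ (dP i)); apply: Uoo; exists i => // m /= im.
  rewrite /c.
  have [_ _ bl ms] := bsP m.
  rewrite (leq_ltn_trans im ms); apply/ltW/bl/mem_nth.
  exact: leq_ltn_trans im ms.
have e0 := norm_basis_gt0 e_basis e_symmetric 0.
(* Scaled so that testing the tail on the single vector [e m] gives [d m <= eps / 2]. *)
have eps'0 : 0 < eps / (2 * `|e 0|) by rewrite divr_gt0// mulr_gt0.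
have [m mP] := bstar_tail dstar eps'0.
have := mP m.+1 (fun i => if i == m then 1 else 0).
rewrite !big_ord_recr /= eqxx mulr1 scale1r.
have im (i : 'I_m) : (i == m :> nat) = false.
  by apply/eqP => im; have := ltn_ord i; rewrite im ltnn.
rewrite !big1 ?add0r => [|i _|i _]; rewrite ?im ?scale0r ?mulr0//.
rewrite (norm_basis e_symmetric m) invfM mulrA divfK ?gt_eqF//.
have dm := dge m => /(_ _) /=.
move=> H1; have : d m <= eps / 2.
  by apply: H1 => i; case: eqP => // ->; rewrite ltnn.
by lra.
Qed.

(** A weak limit of bounded partial sums would have all coordinates 1, but the terms of a convergent
    expansion tend to 0. *)
Lemma norm_sum_unbounded (C : R) : exists P : nat, C < `|\sum_(i < P) e i|.
Proof.
apply: contrapT => H.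
have {}H P : `|\sum_(i < P) e i| <= C.
  by rewrite leNgt; apply/negP => PC; apply: H; exists P.
have [U [UU Uoo]] := free_ultrafilter.
have [x xP] := reflexive_weak_limit UU X_reflexive H.
have [a [ax _]] := e_basis x.
have e0 := norm_basis_gt0 e_basis e_symmetric 0.
have a1 k : a k = 1.
  have [f fP] := dual_coord k.
  have : f x = `|e 0|.
    apply: (cvg_unique _ (xP f)) => //; apply: cvg_near_cst; apply: Uoo.
    exists k.+1 => // m /= km.
    rewrite (_ : \sum_(i < m) e i = \sum_(i < m) 1 *: e i).
      by rewrite (dual_coord_sum fP m (fun=> 1)) km mulr1.
    by apply: eq_bigr => i _; rewrite scale1r.
  rewrite (fP _ _ ax).
  by move=> /(congr1 (fun z => `|e 0|^-1 * z)); rewrite mulKf ?gt_eqF// mulVf ?gt_eqF.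
have : cvg (series (fun n => a n *: e n) @ \oo) by apply/cvg_ex; exists x.
move/cvg_series_cvg_0 => /cvgr_dist_lt/(_ _ e0)[N _ /(_ N (leqnn N))] /=.
by rewrite a1 scale1r sub0r normrN (norm_basis e_symmetric) ltxx.
Qed.

End Reflexive.
End Bstar.

(** * A finite Hahn-Banach theorem *)

Section HahnBanach.
Context (R : realType) (V : lmodType R).

Definition sublinear (q : V -> R) := (forall x y, q (x + y) <= q x + q y) /\
  forall (t : R) x, 0 <= t -> q (t *: x) = t * q x.

(** A Hahn-Banach step that lowers a sublinear functional instead of extending a linear one: [q' x]
    is the infimum over t >= 0 of [q (x + t *: v) - t * q v]. The last property is the case x = - v,
    t = 1. *)
Lemma sublinear_flatten (q : V -> R) (v : V) : sublinear q ->
  exists q' : V -> R, [/\ sublinear q', forall x, q' x <= q x & q' (- v) <= - q v].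
Proof.
move=> [qD qZ].
have q0 : q 0 = 0 by rewrite -(scale0r 0) qZ// mul0r.
pose S x := [set q (x + t *: v) - t * q v | t in [set t | 0 <= t]].
have S0 x : S x !=set0 by exists (q (x + 0 *: v) - 0 * q v), 0 => /=.
have Slb x : lbound (S x) (- q (- x)).
  move=> _ [t /= t0 <-]; have := qD (x + t *: v) (- x).
  by rewrite addrAC subrr add0r qZ//; lra.
have Sinf x : has_inf (S x) by split=> //; exists (- q (- x)).
pose q' x := inf (S x).
have q'le x t : 0 <= t -> q' x <= q (x + t *: v) - t * q v.
  by move=> t0; apply: ge_inf; [exists (- q (- x))|exists t].
have leq' x a : (forall t, 0 <= t -> a <= q (x + t *: v) - t * q v) -> a <= q' x.
  by move=> H; apply: lb_le_inf => // _ [t /= t0 <-]; exact: H.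
have q'q x : q' x <= q x.
  by have := q'le x 0 (lexx 0); rewrite scale0r addr0 mul0r subr0.
have q'Z t x : 0 <= t -> q' (t *: x) <= t * q' x.
  rewrite le_eqVlt => /predU1P[<-|t0].
    by rewrite scale0r mul0r (le_trans (q'q 0))// q0.
  rewrite -ler_pdivrMl//; apply: (leq' _ _) => s s0.
  have ts0 : 0 <= t * s by apply: mulr_ge0 => //; exact: ltW.
  rewrite ler_pdivrMl// (le_trans (q'le _ _ ts0))//.
  by rewrite -scalerA -scalerDr (qZ _ _ (ltW t0)); lra.
exists q'; split=> //; last first.
  by have := q'le (- v) 1 ler01; rewrite scale1r addNr q0 mul1r sub0r.
split=> [x y|t x t0].
  rewrite -lerBlDr; apply: (leq' _ _) => t t0; rewrite lerBlDr -lerBlDl.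
  apply: (leq' _ _) => s s0; have := q'le (x + y) (t + s) (addr_ge0 t0 s0).
  have := qD (x + t *: v) (y + s *: v).
  by rewrite addrACA -scalerDl; lra.
apply/eqP; rewrite eq_le q'Z//=; have [->|tn0] := eqVneq t 0.
  by rewrite mul0r scale0r; apply: (leq' _ _) => s s0; rewrite add0r qZ// subrr.
have {tn0}t0 : 0 < t by rewrite lt_neqAle eq_sym tn0.
have := q'Z t^-1 (t *: x); rewrite invr_ge0 (ltW t0) => /(_ isT).
by rewrite scalerA mulVf ?gt_eqF// scale1r ler_pdivlMl.
Qed.

(** Vectors flattened earlier stay flat, because [q' v + q' (- v)] only decreases. *)
Lemma sublinear_flatten_seq (q : V -> R) (s : seq V) : sublinear q ->
  exists q' : V -> R, [/\ sublinear q', forall x, q' x <= q x &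
    forall v, v \in s -> q' v + q' (- v) <= 0].
Proof.
move=> qS; elim: s => [|v s [q1 [q1S q1q q1s]]]; first by exists q.
have [q2 [q2S q2q1 q2v]] := sublinear_flatten v q1S.
exists q2; split=> // [x|u]; first exact: le_trans (q1q x).
rewrite inE => /predU1P[->|/q1s].
  by have := q2q1 v; lra.
by apply: le_trans; apply: lerD.
Qed.

End HahnBanach.

Lemma bstar_norming (R : realType) (X : completeNormedModType R) (e : nat -> X) :
  one_symmetric e -> forall (N : nat) (x : nat -> R),
  exists2 b, bstar e b & `|\sum_(i < N) x i *: e i| <= \sum_(i < N) b i * x i.
Proof.
move=> e_symmetric N x; pose a := \sum_(i < N) x i *: e i.
have S0 : sublinear (fun y : X => `|y|).
  split=> [y z|t y t0]; first exact: ler_normD.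
  by rewrite normrZ ger0_norm.
(* Flattening at [a] first makes the functional norming at [a]; flattening at the finitely many
   [e i] with i < N then makes it linear on their span, with coefficients [q (e i)]. *)
have [q1 [S1 q1le q1a]] := sublinear_flatten a S0.
have [q [[qD qZ] qle qe]] := sublinear_flatten_seq [seq e i | i <- iota 0 N] S1.
have {}qe i : (i < N)%N -> q (- e i) <= - q (e i).
  move=> iN; have : q (e i) + q (- e i) <= 0.
    by apply/qe/map_f; rewrite mem_iota.
  by lra.
have q0 : q 0 = 0 by rewrite -(scale0r 0) qZ// mul0r.
have qN y : - q (- y) <= q y.
  by have := qD y (- y); rewrite subrr q0; lra.
have qsum (y : nat -> R) : q (\sum_(i < N) y i *: e i) <= \sum_(i < N) q (e i) * y i.
  have : forall M, (M <= N)%N -> q (\sum_(i < M) y i *: e i) <= \sum_(i < M) q (e i) * y i.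
    elim=> [_|M IH MN]; first by rewrite !big_ord0 q0.
    rewrite !big_ord_recr /= (le_trans (qD _ _))// lerD ?IH//; first exact: ltnW.
    have [y0|y0] := leP 0 (y M); first by rewrite qZ// mulrC.
    have Ny0 : 0 <= - y M by rewrite oppr_ge0 ltW.
    rewrite -[y M]opprK scaleNr -scalerN qZ// opprK.
    by have := ler_wpM2l Ny0 (qe _ MN); lra.
  exact.
pose b i := if (i < N)%N then q (e i) else 0.
exists b; last first.
  have := qsum x; rewrite -/a => H.
  rewrite (eq_bigr (fun i : 'I_N => q (e i) * x i)) => [|i _]; last by rewrite /b ltn_ord.
  by apply: le_trans H; have := qN a; have := qle (- a); lra.
move=> M y; pose z i := if (i < M)%N then y i else 0.
have -> : \sum_(i < M) b i * y i = \sum_(i < N) q (e i) * z i.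
  transitivity (\sum_(i < M) (if (i < N)%N then q (e i) * y i else 0)).
    by apply: eq_bigr => i _; rewrite /b; case: ifP; rewrite ?mul0r.
  rewrite (sum_if_swap M N (fun i => q (e i) * y i)).
  by apply: eq_bigr => i _; rewrite /z; case: ifP; rewrite ?mulr0.
have -> : \sum_(i < N) q (e i) * z i = - \sum_(i < N) q (e i) * (- z i).
  by rewrite -sumrN; apply: eq_bigr => i _; rewrite mulrN opprK.
have := qsum (fun i => - z i).
rewrite (_ : \sum_(i < N) - z i *: e i = - \sum_(i < N) z i *: e i); last first.
  by rewrite -sumrN; apply: eq_bigr => i _; rewrite scaleNr.
set u := \sum_(i < N) z i *: e i => H.
have uM : `|u| <= `|\sum_(i < M) y i *: e i|.
  have -> : u = \sum_(i < M) (if (i < N)%N then y i *: e i else 0).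
    rewrite (sum_if_swap M N (fun i => y i *: e i)).
    by apply: eq_bigr => i _; rewrite /z; case: ifP; rewrite ?scale0r.
  rewrite (eq_bigr (fun i : 'I_M => (if (i < N)%N then y i else 0) *: e i)).
    exact: (norm_sum_restrict e_symmetric (fun i => i < N)%N).
  by move=> i _; case: ifP; rewrite ?scale0r.
by have := qN u; have := qle u; have := q1le u; lra.
Qed.

(** * Lebesgue measure of boxes *)

Definition row_set (R : Type) (d : nat) (a : 'rV[R]_d) (i : 'I_d) (s : R) : 'rV[R]_d :=
  \row_j (if j == i then s else a 0 j).

Lemma ler_norm_row (R : realType) (d : nat) (x : 'rV[R]_d) i : `|x 0 i| <= `|x|.
Proof.
rewrite [leRHS]/Num.norm /= mx_normrE; apply/bigmax_geP; right => /=.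
by exists (0, i).
Qed.

Section Boxes.
Context (R : realType) (d : nat).
Local Notation Rd := 'rV[R]_d.+1.
Local Notation Ld := (lebesgue_space R d).

Lemma lebesgue_outer_box (a b : Rd) (A : set Rd) : (forall i, a 0 i <= b 0 i) ->
  A `<=` parallelepiped a b -> (lebesgue_outer A <= (box_volume a b)%:E)%E.
Proof.
move=> ab Aab; pose F k : Rd * Rd := if k is 0%N then (a, b) else (0, 0).
apply: ereal_inf_lbound; exists F.
  split=> [[|k] i //=|x /Aab xab]; by exists 0%N.
have vol0 : box_volume (0 : Rd) 0 = 0.
  by rewrite /box_volume big_ord_recl !mxE subrr mul0r.
rewrite (nneseriesD1 (n := 0%N))// => [|k _]; last first.
  case: k => [|k] /=; last by rewrite vol0.
  by rewrite lee_fin prodr_ge0// => i _; rewrite subr_ge0.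
by rewrite eseries0 ?adde0// => -[|k] //= _ _; rewrite vol0.
Qed.

Definition slab (i : 'I_d.+1) (c eta M : R) : set Rd :=
  [set x | `|x 0 i - c| <= eta /\ forall j, `|x 0 j| < M].

Lemma lebesgue_outer_slab i (c eta M : R) : 0 < eta -> 0 < M ->
  (lebesgue_outer (slab i c eta M) <= (4 * eta * (M + M) ^+ d)%:E)%E.
Proof.
move=> eta0 M0.
(* Covering boxes are open while the slab is closed in direction [i], so the half-thickness is
   doubled; hence the factor 4. *)
pose a : Rd := row_set (\row_j (- M)) i (c - 2 * eta).
pose b : Rd := row_set (\row_j M) i (c + 2 * eta).
have := @lebesgue_outer_box a b (slab i c eta M).
rewrite /box_volume (bigD1 i)//= !mxE eqxx.
rewrite (eq_bigr (fun=> M + M)) => [|j /negbTE ji]; last by rewrite !mxE ji opprK.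
rewrite prodr_const cardC1 card_ord /= (_ : c + _ - _ = 4 * eta); last by lra.
apply=> [j|x [xc xM] j]; rewrite !mxE.
  by case: ifP => _; lra.
case: eqVneq => [->|ji]; last by rewrite -ltr_norml.
by move: xc; rewrite ler_norml; lra.
Qed.

Lemma lebesgue_outer_hyperplane i (c : R) :
  lebesgue_outer [set x : Rd | x 0 i = c] = 0%E.
Proof.
apply/eqP; rewrite eq_le lebesgue_outer_ge0 andbT.
pose H n : set Rd := slab i c 0 n.+1%:R.
have HE : [set x : Rd | x 0 i = c] `<=` \bigcup_n H n.
  move=> x /= xc; exists (Num.truncn `|x|) => //; split=> [|j].
    by rewrite xc subrr normr0.
  apply: le_lt_trans (truncnS_gt _).
  exact: ler_norm_row.
apply: (le_trans (le_lebesgue_outer HE)).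
apply: (le_trans (lebesgue_outer_sigma_subadditive H)).
rewrite eseries0// => n _ _; apply/eqP; rewrite eq_le lebesgue_outer_ge0 andbT.
have n0 : 0 < n.+1%:R :> R by rewrite ltr0n.
apply/lee_addgt0Pr => eps eps0; rewrite add0e.
pose K : R := (n.+1%:R + n.+1%:R) ^+ d.
have K0 : 0 < K by rewrite exprn_gt0// addr_gt0.
have eta0 : 0 < eps / (4 * K) by rewrite divr_gt0// mulr_gt0.
have := lebesgue_outer_slab i c eta0 n0; rewrite -/K.
rewrite (_ : 4 * _ * K = eps).
  apply: le_trans; apply: le_lebesgue_outer => x [xc xn]; split=> //.
  by apply: (le_trans xc); exact: ltW.
by rewrite mulrAC mulrC divfK// mulf_neq0// gt_eqF.
Qed.

Lemma lebesgue_measurable_null (A : set Ld) : lebesgue_outer A = 0%E -> measurable A.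
Proof.
move=> A0; apply: (@le_caratheodory_measurable R _ (@lebesgue_outer R d)) => X.
rewrite [X in (X + _)%E](_ : _ = 0%E).
  by rewrite add0e; apply: le_lebesgue_outer => x [].
apply/eqP; rewrite eq_le lebesgue_outer_ge0 andbT -A0.
by apply: le_lebesgue_outer => x [].
Qed.

Lemma box_volume_cut (a b : Rd) i s :
  box_volume a b = box_volume a (row_set b i s) + box_volume (row_set a i s) b.
Proof.
rewrite /box_volume !(bigD1 i (P := xpredT))//= !mxE eqxx.
have E1 : \prod_(j < d.+1 | j != i) (row_set b i s 0 j - a 0 j) =
    \prod_(j < d.+1 | j != i) (b 0 j - a 0 j).
  by apply: eq_bigr => j /negbTE ji; rewrite mxE ji.
have E2 : \prod_(j < d.+1 | j != i) (b 0 j - row_set a i s 0 j) =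
    \prod_(j < d.+1 | j != i) (b 0 j - a 0 j).
  by apply: eq_bigr => j /negbTE ji; rewrite mxE ji.
by rewrite E1 E2 -mulrDl; congr (_ * _); lra.
Qed.

(** Cutting each box of a cover along the hyperplane preserves total volume; the halves cover the
    two open sides, and the hyperplane itself is null. *)
Lemma measurable_halfspace i (c : R) : measurable ([set x | x 0 i < c] : set Ld).
Proof.
apply: (@le_caratheodory_measurable R _ (@lebesgue_outer R d)) => X.
apply: le_ereal_inf_tmp => _ [F [F0 XF] <-].
(* The cut is clamped to the box: if the hyperplane misses it, one half is degenerate, which covers
   allow. *)
pose s k := Num.max ((F k).1 0 i) (Num.min ((F k).2 0 i) c).
have s1 k : (F k).1 0 i <= s k by rewrite le_max lexx.
have s2 k : s k <= (F k).2 0 i by rewrite ge_max F0 ge_min lexx.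
pose F1 k := ((F k).1, row_set (F k).2 i (s k)).
pose F2 k := (row_set (F k).1 i (s k), (F k).2).
have F10 k j : (F1 k).1 0 j <= (F1 k).2 0 j.
  by rewrite !mxE; case: eqVneq => [->|_]; [exact: s1|exact: F0].
have F20 k j : (F2 k).1 0 j <= (F2 k).2 0 j.
  by rewrite !mxE; case: eqVneq => [->|_]; [exact: s2|exact: F0].
have vol0 (G : nat -> Rd * Rd) k : (forall k j, (G k).1 0 j <= (G k).2 0 j) ->
    (0 <= (box_volume (G k).1 (G k).2)%:E)%E.
  by move=> G0; rewrite lee_fin prodr_ge0// => j _; rewrite subr_ge0.
have -> : (\sum_(k <oo) (box_volume (F k).1 (F k).2)%:E =
    \sum_(k <oo) (box_volume (F1 k).1 (F1 k).2)%:E +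
    \sum_(k <oo) (box_volume (F2 k).1 (F2 k).2)%:E)%E.
  rewrite -nneseriesD => [|k _ _|k _ _]; [|exact: vol0|exact: vol0].
  by apply: eq_eseriesr => k _; rewrite -EFinD -box_volume_cut.
apply: leeD.
  apply: ereal_inf_lbound; exists F1 => //; split=> // x [/XF[k _ xF] /= xc].
  exists k => // j; rewrite !mxE; have /andP[-> xj2] := xF j => /=.
  case: eqVneq => [ji|_//]; rewrite ji in xj2 *.
  by rewrite lt_max lt_min xj2 xc orbT.
have -> : X `&` ~` [set x : Ld | x 0 i < c] =
    (X `&` [set x : Ld | x 0 i > c]) `|` (X `&` [set x : Ld | x 0 i = c]).
  apply/seteqP; split=> [x [Xx /= /negP]|x [[Xx /= xc]|[Xx /= xc]]].
  - by rewrite -leNgt le_eqVlt => /orP[/eqP|]; [right|left].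
  - by split=> //; apply/negP; rewrite -leNgt ltW.
  - by split=> //; rewrite xc ltxx.
apply: (le_trans (outer_measureU2 (@lebesgue_outer R d) _ _)).
rewrite [X in (_ + X)%E](_ : _ = 0%E) ?adde0; last first.
  apply/eqP; rewrite eq_le lebesgue_outer_ge0 andbT -(lebesgue_outer_hyperplane i c).
  by apply: le_lebesgue_outer => x [].
apply: ereal_inf_lbound; exists F2 => //; split=> // x [/XF[k _ xF] /= xc].
exists k => // j; rewrite !mxE; have /andP[xj1 ->] := xF j; rewrite andbT.
case: eqVneq => [ji|_//]; rewrite ji in xj1 *.
by rewrite gt_max xj1 gt_min xc orbT.
Qed.

Lemma measurable_hyperplane i (c : R) : measurable ([set x | x 0 i = c] : set Ld).
Proof. exact/lebesgue_measurable_null/lebesgue_outer_hyperplane. Qed.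

Lemma measurable_parallelepiped (a b : Rd) : measurable (parallelepiped a b : set Ld).
Proof.
have -> : (parallelepiped a b : set Ld) = \bigcap_(i in setT)
    (~` ([set x : Ld | x 0 i < a 0 i] `|` [set x : Ld | x 0 i = a 0 i]) `&`
     [set x : Ld | x 0 i < b 0 i]).
  apply/seteqP; split=> [x xab i _|x xab i].
    have /andP[ai bi] := xab i; split=> //= -[|xi]; first by rewrite ltNge ltW.
    by move: ai; rewrite xi ltxx.
  have [/= nai ->] := xab i I; rewrite andbT ltNge le_eqVlt; apply/negP => /orP[/eqP|] H.
    by apply: nai; right.
  by apply: nai; left.
apply: fin_bigcap_measurable => // i _; apply: measurableI.
  by apply/measurableC/measurableU; [exact: measurable_halfspace|exact: measurable_hyperplane].
exact: measurable_halfspace.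
Qed.

Lemma measurable_open (Omega : set Rd) : open Omega -> measurable (Omega : set Ld).
Proof.
move=> oO.
pose B (p : 'rV[rat]_d.+1 * 'rV[rat]_d.+1) : set Ld :=
  parallelepiped (map_mx ratr p.1) (map_mx ratr p.2).
pose C p := if `[< B p `<=` Omega >] then B p else set0.
have -> : (Omega : set Ld) = \bigcup_p C p.
  apply/seteqP; split=> [x Ox|x [p _]]; last by rewrite /C; case: asboolP => // pO /pO.
  have /nbhs_ballP[eps /= eps0 xO] : nbhs (x : Rd) Omega by exact: open_nbhs_nbhs.
  have /choice[p pP] i : exists q : rat, x 0 i - eps < ratr q < x 0 i.
    have : x 0 i - eps < x 0 i by rewrite ltrBlDr ltrDl.
    by move=> /rat_in_itvoo[q]; rewrite in_itv /=; exists q.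
  have /choice[q qP] i : exists q : rat, x 0 i < ratr q < x 0 i + eps.
    have : x 0 i < x 0 i + eps by rewrite ltrDl.
    by move=> /rat_in_itvoo[q]; rewrite in_itv /=; exists q.
  exists (\row_i p i, \row_i q i) => //; rewrite /C asboolT.
    by move=> i; rewrite !mxE; have /andP[_ ->] := pP i; have /andP[-> _] := qP i.
  move=> y yB; apply: xO; split=> // i j; rewrite ord1.
  have := yB j; rewrite !mxE; have := pP j; have := qP j => /andP[? ?] /andP[? ?] /andP[? ?].
  by rewrite /ball /= ltr_norml; lra.
apply: countable_bigcupT_measurable; first exact: countableP.
by move=> p; rewrite /C; case: asboolP => // _; exact: measurable_parallelepiped.
Qed.

End Boxes.

(** * Integrals over boxes *)

Section IntegralOnSubsets.
Context (disp : measure_display) (T : measurableType disp) (R : realType).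
Context (mu : {measure set T -> \bar R}) (D : set T) (f : T -> R).
Hypotheses (mD : measurable D) (fD : mu.-integrable D (EFin \o f)).

Lemma Rintegral_small (eps : R) : 0 < eps -> exists2 delta : R, 0 < delta &
  forall A, measurable A -> A `<=` D -> (mu A < delta%:E)%E ->
    \int[mu]_(x in A) `|f x| < eps.
Proof.
move=> eps0; have fD' : mu.-integrable setT (EFin \o (f \_ D)).
  by rewrite -restrict_EFin; apply/(integrable_mkcond _ mD).
have [delta [delta0 H]] := integral_normr_continuous fD' eps0.
exists delta => // A mA AD /(H _ mA); apply: le_lt_trans.
rewrite le_eqVlt; apply/orP; left; apply/eqP/eq_Rintegral => x /set_mem/AD Dx.
by rewrite patchE mem_set.
Qed.

Lemma Rintegral_split A B : measurable A -> measurable B -> A `<=` D ->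
  \int[mu]_(x in A) f x =
  \int[mu]_(x in A `&` B) f x + \int[mu]_(x in A `\` B) f x.
Proof.
move=> mA mB AD; rewrite -Rintegral_setU ?setUIDK//.
- exact: measurableI.
- exact: measurableD.
- exact: integrableS fD.
- by apply/disj_setPS => x [[_ Bx] [_ /(_ Bx)]].
Qed.

Lemma le_norm_RintegralB A B : measurable A -> measurable B ->
  A `<=` D -> B `<=` D ->
  `|\int[mu]_(x in A) f x - \int[mu]_(x in B) f x| <=
  \int[mu]_(x in A `\` B) `|f x| + \int[mu]_(x in B `\` A) `|f x|.
Proof.
move=> mA mB AD BD; rewrite (Rintegral_split mA mB AD) (Rintegral_split mB mA BD).
rewrite [B `&` A]setIC opprD addrACA subrr add0r (le_trans (ler_normB _ _))//.
have int' E : measurable E -> E `<=` D -> mu.-integrable E (EFin \o f).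
  by move=> mE ED; exact: integrableS fD.
apply: lerD; apply: le_normr_Rintegral; try exact: measurableD.
  by apply: int'; [exact: measurableD|move=> x [/AD]].
by apply: int'; [exact: measurableD|move=> x [/BD]].
Qed.

Lemma Rintegral_setD_null A N : measurable A -> measurable N -> A `<=` D ->
  mu N = 0%E -> \int[mu]_(x in A) f x = \int[mu]_(x in A `\` N) f x.
Proof.
move=> mA mN AD N0; rewrite /Rintegral (negligible_integral mN mA)//.
exact: integrableS fD.
Qed.

Lemma sum_norm_Rintegral_le (m : nat) (A : nat -> set T) :
  (forall j, measurable (A j)) -> (forall j, A j `<=` D) ->
  (forall i j, i != j -> A i `&` A j = set0) ->
  \sum_(j < m) `|\int[mu]_(x in A j) f x| <= \int[mu]_(x in D) `|f x|.
Proof.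
move=> mA AD A0; pose U k := \big[setU/set0]_(j < k) A j.
have mU k : measurable (U k) by apply: bigsetU_measurable => j _; exact: mA.
have UD k : U k `<=` D.
  by rewrite /U -bigcup_mkord => x [j _] /AD.
have int' E : measurable E -> E `<=` D -> mu.-integrable E (EFin \o (Num.Def.normr \o f)).
  by move=> mE ED; apply: integrable_norm; exact: integrableS fD.
have -> : \int[mu]_(x in D) `|f x| =
    \int[mu]_(x in U m) `|f x| + \int[mu]_(x in D `\` U m) `|f x|.
  have DU : U m `|` D `\` U m = D by rewrite setDUK.
  rewrite -[in LHS]DU Rintegral_setU//.
  - exact: measurableD.
  - by rewrite DU; exact: int'.
  - by apply/disj_setPS => x [? []].
rewrite -[leLHS]addr0 lerD//; last by apply: Rintegral_ge0.
elim: m => [|m IH]; first by rewrite /U !big_ord0 Rintegral_set0.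
rewrite big_ord_recr /= {1}/U big_ord_recr /= -/(U m) Rintegral_setU//.
- apply: lerD => //; apply: le_normr_Rintegral => //.
  exact: integrableS fD.
- by apply: int'; [exact: measurableU|move=> x [/UD|/AD]].
- apply/disj_setPS; rewrite /U -bigcup_mkord => x [[j /= jm Aj] Am].
  have jm' : j != m by rewrite ltn_eqF.
  by have := A0 _ _ jm'; rewrite predeqE => /(_ x)[+ _]; apply.
Qed.

End IntegralOnSubsets.

Section BoxIntegral.
Context (R : realType) (d : nat) (Omega : set 'rV[R]_d.+1).
Hypotheses (Omega_open : open Omega) (Omega_bounded : bounded_set Omega).
Local Notation Rd := 'rV[R]_d.+1.

Definition box_integral (f : lebesgue_space R d -> R) (p : Rd * Rd) : R :=
  \int[@lebesgue R d]_(x in parallelepiped p.1 p.2) f x.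

Definition box_close (eta : R) (p q : Rd * Rd) := forall i,
  `|p.1 0 i - q.1 0 i| <= eta /\ `|p.2 0 i - q.2 0 i| <= eta.

Definition box_in (p : Rd * Rd) := parallelepiped p.1 p.2 `<=` Omega.

(** A point of the difference is within [eta] of a face of the second box, hence in one of two slabs
    per direction; 8 is twice the slab factor 4. *)
Lemma lebesgue_outer_boxD (M eta : R) (p q : Rd * Rd) : 0 < M -> 0 < eta ->
  (forall x, parallelepiped p.1 p.2 x -> forall j, `|x 0 j| < M) ->
  box_close eta p q ->
  (lebesgue_outer (parallelepiped p.1 p.2 `\` parallelepiped q.1 q.2) <=
    (d.+1%:R * (8 * (M + M) ^+ d) * eta)%:E)%E.
Proof.
move=> M0 eta0 pM pq.
pose F k := slab (inord k : 'I_d.+1) (q.1 0 (inord k)) eta M `|`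
  slab (inord k) (q.2 0 (inord k)) eta M.
have : parallelepiped p.1 p.2 `\` parallelepiped q.1 q.2 `<=`
    \big[setU/set0]_(k < d.+1) F k.
  rewrite -bigcup_mkord => x [xp xq].
  have /existsNP[i xi] := xq.
  exists (val i) => /=; first exact: ltn_ord.
  rewrite /F inord_val /=; have /andP[p1 p2] := xp i; have [p1q p2q] := pq i.
  move: p1q p2q; rewrite !ler_norml => /andP[? ?] /andP[? ?].
  have [xq1|xq1] := leP (x 0 i) (q.1 0 i).
    by left; split; [rewrite ler_norml; lra|exact: pM].
  right; split; last exact: pM.
  have : q.2 0 i <= x 0 i by rewrite leNgt; apply/negP => xq2; apply: xi; rewrite xq1.
  by rewrite ler_norml; lra.
move=> /le_lebesgue_outer /le_trans; apply.
apply: (le_trans (outer_measure_subadditive (@lebesgue_outer R d) F d.+1)).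
apply: (@le_trans _ _ (\sum_(k < d.+1) (8 * (M + M) ^+ d * eta)%:E)%E); last first.
  rewrite sumEFin lee_fin sumr_const card_ord -mulr_natl; lra.
apply: lee_sum => k _.
apply: (le_trans (outer_measureU2 (@lebesgue_outer R d) _ _)).
apply: le_trans (leeD (lebesgue_outer_slab _ _ eta0 M0) (lebesgue_outer_slab _ _ eta0 M0)) _.
by rewrite -EFinD lee_fin; lra.
Qed.

Lemma bounded_coord : exists2 M : R, 0 < M & forall x, Omega x -> forall j, `|x 0 j| < M.
Proof.
have [M [_ MO]] := Omega_bounded.
exists (`|M| + 2); first by rewrite ltr_wpDl.
move=> x /(MO (`|M| + 1)) H j; apply: (le_lt_trans (ler_norm_row x j)).
have : M < `|M| + 1 by rewrite (le_lt_trans (ler_norm M))// ltrDl.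
by move=> /H /le_lt_trans; apply; lra.
Qed.

Section WithFunction.
Variable f : lebesgue_space R d -> R.
Hypothesis f_L1 : L1 Omega f.

Let mO := measurable_open Omega_open.

Lemma box_integral_continuous (eps : R) : 0 < eps -> exists2 eta : R, 0 < eta &
  forall p q, box_in p -> box_in q -> box_close eta p q ->
    `|box_integral f p - box_integral f q| < eps.
Proof.
move=> eps0; have eps2 : 0 < eps / 2 by lra.
have [delta delta0 H] := Rintegral_small mO f_L1 eps2.
have [M M0 OM] := bounded_coord.
pose K : R := d.+1%:R * (8 * (M + M) ^+ d).
have K0 : 0 < K by rewrite !mulr_gt0// exprn_gt0// addr_gt0.
(* With this bound each one-sided difference of the boxes has measure at most [delta / 2], strictly
   below [delta]. *)
exists (delta / (2 * K)); first by rewrite divr_gt0// mulr_gt0.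
move=> p q pO qO pq; rewrite /box_integral.
have small p' q' : box_in p' -> box_close (delta / (2 * K)) p' q' ->
    \int[@lebesgue R d]_(x in parallelepiped p'.1 p'.2 `\` parallelepiped q'.1 q'.2) `|f x| < eps / 2.
  move=> pO' pq'; apply: H.
  - by apply: measurableD; exact: measurable_parallelepiped.
  - by move=> x [/pO'].
  apply: (@le_lt_trans _ _ (K * (delta / (2 * K)))%:E).
    apply: lebesgue_outer_boxD => //; first by rewrite divr_gt0// mulr_gt0.
    by move=> x /pO'; exact: OM.
  rewrite lte_fin invfM mulrCA [K * _]mulrCA divff ?gt_eqF// mulr1; lra.
have qp : box_close (delta / (2 * K)) q p by move=> i; rewrite distrC [X in _ /\ X <= _]distrC; exact: pq.
apply: le_lt_trans (le_norm_RintegralB mO f_L1 _ _ pO qO) _.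
- exact: measurable_parallelepiped.
- exact: measurable_parallelepiped.
by have := small _ _ pO pq; have := small _ _ qO qp; lra.
Qed.

Lemma box_integral_cut (a b : Rd) i s : box_in (a, b) -> a 0 i <= s <= b 0 i ->
  box_integral f (a, b) = box_integral f (a, row_set b i s) + box_integral f (row_set a i s, b).
Proof.
move=> abO /andP[as_ sb]; rewrite /box_integral /=.
have mp := @measurable_parallelepiped R d.
rewrite (Rintegral_setD_null mO f_L1 (mp a b) (measurable_hyperplane i s))//; last first.
  exact: lebesgue_outer_hyperplane.
have E : parallelepiped a b `\` [set x : Rd | x 0 i = s] =
   parallelepiped a (row_set b i s) `|` parallelepiped (row_set a i s) b.
  apply/seteqP; split=> [x [xab /= /eqP xs]|x].
    have [xis|xis] := ltP (x 0 i) s; [left|right] => j; have /andP[x1 x2] := xab j;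
      rewrite mxE ?x1 ?x2 ?andbT/=; case: eqVneq => // -> //.
    by rewrite lt_neqAle xis eq_sym xs.
  move=> [] xab; split=> /=.
  - move=> j; have := xab j; rewrite mxE; case: eqVneq => // -> /andP[-> /= /lt_le_trans]; exact.
  - by move=> xs; have := xab i; rewrite mxE eqxx xs ltxx andbF.
  - move=> j; have := xab j; rewrite mxE; case: eqVneq => // -> /andP[/(le_lt_trans as_) -> ->//].
  - by move=> xs; have := xab i; rewrite mxE eqxx xs ltxx.
rewrite E Rintegral_setU//.
- rewrite -E; apply: integrableS f_L1 => //; last by move=> x [/abO].
  by apply: measurableD => //; exact: measurable_hyperplane.
- apply/disj_setPS => x [x1 x2]; have := x1 i; have := x2 i; rewrite !mxE eqxx => /andP[sx _] /andP[_ xs].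
  by have := lt_trans sx xs; rewrite ltxx.
Qed.

Lemma sum_norm_box_integral (m : nat) (p : nat -> Rd * Rd) :
  (forall j, box_in (p j)) ->
  (forall i j, i != j -> parallelepiped (p i).1 (p i).2 `&` parallelepiped (p j).1 (p j).2 = set0) ->
  \sum_(j < m) `|box_integral f (p j)| <= \int[@lebesgue R d]_(x in Omega) `|f x|.
Proof.
move=> pO p0.
exact: (sum_norm_Rintegral_le mO f_L1 m (fun j => measurable_parallelepiped (p j).1 (p j).2) pO p0).
Qed.

Lemma box_integral_empty p : parallelepiped p.1 p.2 = set0 -> box_integral f p = 0.
Proof. by rewrite /box_integral => ->; rewrite Rintegral_set0. Qed.

End WithFunction.

Lemma L1_lin (l : R) f g : L1 Omega f -> L1 Omega g -> L1 Omega (fun x => l * f x + g x).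
Proof.
move=> fL gL; have mO := measurable_open Omega_open.
rewrite /L1 /mkset; have -> : (EFin \o (fun x => l * f x + g x)) = ((fun x => l%:E * (EFin \o f) x) \+ (EFin \o g))%E.
  by apply/funext => x /=; rewrite EFinD EFinM.
by apply: integrableD => //; exact: integrableZl.
Qed.

Lemma box_integral_lin (l : R) f g p : box_in p -> L1 Omega f -> L1 Omega g ->
  box_integral (fun x => l * f x + g x) p = l * box_integral f p + box_integral g p.
Proof.
move=> pO fL gL; have mO := measurable_open Omega_open.
have mp := measurable_parallelepiped p.1 p.2.
have int' h : L1 Omega h -> (@lebesgue R d).-integrable (parallelepiped p.1 p.2) (EFin \o h).
  by move=> hL; exact: integrableS hL.
rewrite /box_integral RintegralD//; [|exact: (integrableZl mp l (int' f fL))|exact: int'].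
by rewrite RintegralZl//; exact: int'.
Qed.

Lemma L1_0 : L1 Omega (fun=> 0).
Proof. exact: integrable0. Qed.

Lemma L1_sum n (l : nat -> R) (f : nat -> lebesgue_space R d -> R) :
  (forall k, L1 Omega (f k)) -> L1 Omega (fun x => \sum_(k < n) l k * f k x).
Proof.
move=> fL; elim: n => [|n IH].
  by under eq_fun do rewrite big_ord0; exact: L1_0.
under eq_fun do rewrite big_ord_recr /= addrC.
exact: L1_lin.
Qed.

Lemma box_integral_sum n (l : nat -> R) (f : nat -> lebesgue_space R d -> R) p :
  box_in p -> (forall k, L1 Omega (f k)) ->
  box_integral (fun x => \sum_(k < n) l k * f k x) p = \sum_(k < n) l k * box_integral (f k) p.
Proof.
move=> pO fL; elim: n => [|n IH].
  rewrite big_ord0 /box_integral; under eq_Rintegral do rewrite big_ord0.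
  by rewrite Rintegral_cst ?mul0r//; exact: measurable_parallelepiped.
rewrite big_ord_recr /= -IH addrC -(box_integral_lin (l n) pO (fL n) (L1_sum n l fL)).
by apply: eq_Rintegral => x _; rewrite big_ord_recr /= addrC.
Qed.

End BoxIntegral.

(** * Simons' inequality *)

(** Iterated midpoints are enough for Simons' inequality, where the weights are 2^-n and half of the
    remaining mass is spent at each step. *)
Inductive dyadic_hull (R : realType) (G : Type) (h : nat -> G -> R) (n : nat) :
    (G -> R) -> Prop :=
| dyadic_hull_gen k : (n <= k)%N -> dyadic_hull h n (h k)
| dyadic_hull_mid g1 g2 : dyadic_hull h n g1 -> dyadic_hull h n g2 ->
    dyadic_hull h n (fun x => (g1 x + g2 x) / 2).

Section Simons.
Context (R : realType) (G : Type) (h : nat -> G -> R) (C c : R) (x0 : G).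
Hypothesis h_bounded : forall k x, `|h k x| <= C.
Local Notation hull := (dyadic_hull h).

Lemma dyadic_hull_le m n g : (m <= n)%N -> hull n g -> hull m g.
Proof.
move=> mn; elim=> [k nk|g1 g2 _ IH1 _ IH2].
  by apply: dyadic_hull_gen; exact: leq_trans nk.
exact: dyadic_hull_mid.
Qed.

Lemma dyadic_hull_bounded n g : hull n g -> forall x, `|g x| <= C.
Proof.
elim=> [k _ x|g1 g2 _ IH1 _ IH2 x]; first exact: h_bounded.
have := IH1 x; have := IH2 x; rewrite !ler_norml; lra.
Qed.

(** An average reaching [a] has a term reaching [a]. The bound [B] depends on [g] alone, as needed
    when the point varies with N. *)
Lemma dyadic_hull_large n g : hull n g -> exists B, forall x a, a <= g x ->
  exists k, [/\ (n <= k)%N, (k < B)%N & a <= h k x].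
Proof.
elim=> [k nk|g1 g2 _ [B1 H1] _ [B2 H2]].
  by exists k.+1 => x a ax; exists k.
exists (maxn B1 B2) => x a ax.
have [/H1|g1a] := leP a (g1 x).
  by move=> [k [nk kB ak]]; exists k; split=> //; rewrite leq_max kB.
have /H2[k [nk kB ak]] : a <= g2 x by lra.
by exists k; split=> //; rewrite leq_max kB orbT.
Qed.

Lemma dyadic_hull_comb n g : hull n g -> exists (N : nat) (l : nat -> R),
  [/\ forall k, 0 <= l k, \sum_(k < N) l k = 1 &
      forall x, g x = \sum_(k < N) l k * h k x].
Proof.
have trunc (N M : nat) (l F : nat -> R) : (N <= M)%N ->
    \sum_(k < N) l k * F k = \sum_(k < M) (if (k < N)%N then l k else 0) * F k.
  move=> NM; rewrite (big_ord_widen _ (fun k => l k * F k) NM) big_mkcond /=.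
  by apply: eq_bigr => k _; case: ifP; rewrite ?mul0r.
elim=> [k _|g1 g2 _ [N1 [l1 [l10 l11 H1]]] _ [N2 [l2 [l20 l21 H2]]]].
  exists k.+1, (fun i => if i == k then 1 else 0).
  have E (F : nat -> R) : \sum_(i < k.+1) (if i == k :> nat then 1 else 0) * F i = F k.
    rewrite big_ord_recr /= eqxx mul1r big1 ?add0r// => i _.
    by rewrite ifF ?mul0r//; apply/eqP => ik; have := ltn_ord i; rewrite ik ltnn.
  split=> [i||x]; first by case: ifP.
  - by rewrite -[RHS](E (fun=> 1)); apply: eq_bigr => i _; rewrite mulr1.
  - by rewrite (E (h^~ x)).
pose M := maxn N1 N2.
pose l k := ((if (k < N1)%N then l1 k else 0) + (if (k < N2)%N then l2 k else 0)) / 2.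
have E (F : nat -> R) : \sum_(k < M) l k * F k =
    (\sum_(k < N1) l1 k * F k + \sum_(k < N2) l2 k * F k) / 2.
  rewrite (trunc N1 M) ?leq_maxl// (trunc N2 M) ?leq_maxr// -big_split mulr_suml.
  by apply: eq_bigr => k _; rewrite /l /=; lra.
exists M, l; split=> [k||x].
- have := l10 k; have := l20 k; rewrite /l; case: ifP; case: ifP; lra.
- have E1 N (k : nat -> R) : \sum_(i < N) k i = \sum_(i < N) k i * 1.
    by apply: eq_bigr => i _; rewrite mulr1.
  by rewrite E1 (E (fun=> 1)) -!E1 l11 l21; lra.
- by rewrite (E (h^~ x)) -H1 -H2.
Qed.

Definition fun_sup (F : G -> R) := sup (range F).

Let bnd (F : G -> R) := exists K, forall x, `|F x| <= K.

Let fun_sup_ub F x : bnd F -> F x <= fun_sup F.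
Proof.
move=> [K FK]; apply: ub_le_sup; last by exists x.
by exists K => _ [y _ <-]; exact: le_trans (ler_norm _) (FK y).
Qed.

Let fun_sup_le F a : (forall x, F x <= a) -> fun_sup F <= a.
Proof.
by move=> Fa; apply: ge_sup; [exists (F x0), x0|move=> _ [x _ <-]].
Qed.

Let fun_sup_adh F eta : bnd F -> 0 < eta -> exists x, fun_sup F - eta < F x.
Proof.
move=> [K FK] eta0.
have hs : has_sup (range F).
  split; first by exists (F x0), x0.
  by exists K => _ [y _ <-]; exact: le_trans (ler_norm _) (FK y).
by have [_ [x _ <-]] := sup_adherent eta0 hs; exists x.
Qed.

Let bnd_comb F g (a b : R) : bnd F -> bnd g -> bnd (fun x => a * F x + b * g x).
Proof.
move=> [K FK] [L gL]; exists (`|a| * K + `|b| * L) => x.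
by rewrite (le_trans (ler_normD _ _))// !normrM lerD// ler_wpM2l.
Qed.

Let hull_bnd n g : hull n g -> bnd g.
Proof. by move=> ng; exists C; exact: dyadic_hull_bounded ng. Qed.

Lemma near_min_exists n F (a eps : R) : bnd F -> 0 < eps -> 0 <= a ->
  exists g, hull n g /\ forall g', hull n g' ->
    fun_sup (fun x => F x + a * g x) <= fun_sup (fun x => F x + a * g' x) + eps.
Proof.
move=> bF eps0 a0.
pose V := [set fun_sup (fun x => F x + a * g x) | g in hull n].
have bV g : hull n g -> bnd (fun x => F x + a * g x).
  move=> ng; have [K H] := bnd_comb 1 a bF (hull_bnd ng).
  by exists K => x; have := H x; rewrite mul1r.
have hi : has_inf V.
  split; first by exists (fun_sup (fun x => F x + a * h n x)), (h n) => //; exact: dyadic_hull_gen.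
  exists (F x0 - a * C) => _ [g ng <-].
  apply: le_trans (fun_sup_ub x0 (bV g ng)); rewrite lerD2l -mulrN ler_wpM2l//.
  by have := dyadic_hull_bounded ng x0; rewrite ler_norml => /andP[].
have [_ [g ng <-] H] := inf_adherent eps0 hi.
exists g; split=> // g' ng'; rewrite (le_trans (ltW H))// lerD2r.
by apply: ge_inf; [exact: hi.2|exists g'].
Qed.

Let w (n : nat) : R := 2^-1 ^+ n.
Let w_gt0 n : 0 < w n. Proof. by rewrite exprn_gt0. Qed.
Let wS n : w n.+1 = w n / 2. Proof. by rewrite /w exprSr. Qed.
Let w_le m n : (m <= n)%N -> w n <= w m.
Proof.
move/subnKC <-; elim: (n - m)%N => [|k IH]; first by rewrite addn0.
by rewrite addnS wS; have := w_gt0 (m + k); lra.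
Qed.

(* Oja's proof of Simons' inequality: the greedy choice of g_n keeps sup H_n at
   least c w_n below sup (H_N + 2 w_N g_N) for all N >= n, so that at a point y_N
   almost attaining the latter some g_k with n <= k < n + r must be large, where
   r does not depend on N. *)
Lemma simons : 0 < c -> (forall g, hull 0 g -> c <= fun_sup g) ->
  exists y : nat -> G, forall n, exists B, \forall N \near \oo,
    exists k, [/\ (n <= k)%N, (k < B)%N & c / 4 <= h k (y N)].
Proof.
move=> c0 hc.
(* The greedy choice is made for all pairs (n, F) at once, so that [H] can be defined by recursion;
   at an unbounded F it returns the default [h 0]. The slack c w_n^2 / 2 is tuned to the induction
   in [gap]. *)
have /choice[P PP] (nF : nat * (G -> R)) : exists g, bnd nF.2 -> hull nF.1 g /\
    forall g', hull nF.1 g' -> fun_sup (fun x => nF.2 x + 2 * w nF.1 * g x) <=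
      fun_sup (fun x => nF.2 x + 2 * w nF.1 * g' x) + c * w nF.1 ^+ 2 / 2.
  have [bF|nbF] := pselect (bnd nF.2); last by exists (h 0).
  have e0 : 0 < c * w nF.1 ^+ 2 / 2 by rewrite divr_gt0// mulr_gt0// exprn_gt0.
  have w0 : 0 <= 2 * w nF.1 by rewrite mulr_ge0// ltW.
  by have [g gP] := near_min_exists nF.1 bF e0 w0; exists g.
pose H := fix H n := if n is n'.+1 then fun x => H n' x + w n' * P (n', H n') x
  else fun=> 0 : R.
pose g n := P (n, H n).
have HS n x : H n.+1 x = H n x + w n * g n x by [].
have bH n : bnd (H n).
  elim: n => [|n IH]; first by exists 0 => x; rewrite normr0.
  have [ng _] := PP (n, H n) IH.
  have [K KP] := bnd_comb 1 (w n) IH (hull_bnd ng).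
  by exists K => x; have := KP x; rewrite mul1r.
have gP n : hull n (g n) by have [] := PP (n, H n) (bH n).
pose A n := fun_sup (fun x => H n x + 2 * w n * g n x).
have bHg n g' k : hull k g' -> bnd (fun x => H n x + 2 * w n * g' x).
  move=> kg; have [K KP] := bnd_comb 1 (2 * w n) (bH n) (hull_bnd kg).
  by exists K => x; have := KP x; rewrite mul1r.
have gmin n g' : hull n g' -> A n <= fun_sup (fun x => H n x + 2 * w n * g' x) + c * w n ^+ 2 / 2.
  by have [_] := PP (n, H n) (bH n); apply.
(* As w_n = 2 w_(n+1), the increments after [H n] together with the final term amount to 2 w_n times
   a single element of the hull. *)
have tail n r : exists g', hull n g' /\ forall x,
    H n x + 2 * w n * g' x = H (n + r)%N x + 2 * w (n + r)%N * g (n + r)%N x.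
  elim: r n => [|r IH] n; first by exists (g n); split=> // x; rewrite addn0.
  have [g' [ng' g'E]] := IH n.+1.
  exists (fun x => (g n x + g' x) / 2); split.
    by apply: dyadic_hull_mid => //; exact: dyadic_hull_le ng'.
  by move=> x; rewrite addnS -addSn -g'E HS wS; lra.
have AA n N : (n <= N)%N -> A n <= A N + c * w n ^+ 2 / 2.
  move=> nN; have [g' [ng' g'E]] := tail n (N - n)%N.
  apply: (le_trans (gmin n g' ng')); rewrite lerD2r.
  apply: fun_sup_le => x; rewrite g'E subnKC//.
  exact: (@fun_sup_ub (fun x => H N x + 2 * w N * g N x) x (bHg N _ N (gP N))).
have A2c N : 2 * c <= A N.
  have [g' [g0 g'E]] := tail 0%N N; rewrite add0n in g'E.
  suff : c <= A N / 2 by lra.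
  apply: (le_trans (hc _ g0)); apply: fun_sup_le => x.
  have := @fun_sup_ub (fun x => H N x + 2 * w N * g N x) x (bHg N _ N (gP N)).
  by rewrite -/(A N) -g'E /= /w expr0; lra.
have SH n : fun_sup (H n.+1) <= (fun_sup (H n) + A n) / 2.
  apply: fun_sup_le => x; rewrite HS.
  have := fun_sup_ub x (bH n).
  have := @fun_sup_ub (fun x => H n x + 2 * w n * g n x) x (bHg n _ n (gP n)).
  by rewrite -/(A n); lra.
(* The factor 1 + w_n absorbs the slacks: halving the bound at n and subtracting c w_n^2 / 4 leaves
   exactly the bound at n + 1. At n = 0 it reads 2 c, given by [A2c]. *)
have gap n N : (n <= N)%N -> c * w n * (1 + w n) <= A N - fun_sup (H n).
  elim: n => [_|n IH nN].
    have : fun_sup (H 0%N) <= 0 by apply: fun_sup_le.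
    by have := A2c N; rewrite /w expr0; lra.
  have := IH (ltnW nN); have := SH n; have := AA _ _ (ltnW nN).
  by rewrite wS expr2; lra.
have /choice[y yP] N : exists x, A N - c * w N / 4 < H N x + 2 * w N * g N x.
  by apply: (fun_sup_adh (bHg N _ N (gP N))); rewrite divr_gt0// mulr_gt0.
exists y => n.
have C0 : 0 <= C by apply: le_trans (h_bounded 0 x0).
(* After stage n + r the remaining mass 2 w_(n+r) contributes at most c w_n / 4, whatever N is. *)
have [r rP] : exists r, 8 * C * w r <= c.
  have [m Hm] : exists m : nat, 8 * C <= m%:R * c.
    exists (Num.truncn (8 * C / c)).+1.
    by rewrite -ler_pdivrMr// ltW// truncnS_gt.
  exists m; apply: (@le_trans _ _ (m%:R * c * w m)).
    by apply: ler_wpM2r => //; exact: ltW.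
  rewrite mulrAC ler_piMl//; first exact: ltW.
  rewrite /w exprVn ler_pdivrMr ?exprn_gt0// mul1r -natrX ler_nat.
  by rewrite ltnW// ltn_expl.
have Hrange m s x : H (m + s)%N x - H m x = \sum_(i < s) w (m + i)%N * g (m + i)%N x.
  elim: s => [|s IH]; first by rewrite addn0 big_ord0 subrr.
  by rewrite addnS HS big_ord_recr /= -IH; lra.
have /choice[B BP] k := dyadic_hull_large (gP k).
exists (\max_(i < r) B (n + i)%N); exists (n + r)%N => // N /= nrN.
have nN : (n <= N)%N by apply: leq_trans nrN; exact: leq_addr.
have low : 3 / 4 * c * w n <= H N (y N) + 2 * w N * g N (y N) - H n (y N).
  have := yP N; have := gap n N nN; have := fun_sup_ub (y N) (bH n).
  have := ler_wpM2l (ltW c0) (w_le nN).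
  have : 0 <= c * w n * w n by rewrite ltW// !mulr_gt0.
  by rewrite /=; lra.
have up : H N (y N) + 2 * w N * g N (y N) - H (n + r)%N (y N) <= c * w n / 4.
  have [g' [ng' g'E]] := tail (n + r)%N (N - (n + r))%N.
  rewrite subnKC// in g'E; rewrite -g'E.
  have -> : w (n + r)%N = w n * w r by rewrite /w exprD.
  have : g' (y N) <= C by apply: le_trans (ler_norm _) (dyadic_hull_bounded ng' _).
  have := ler_wpM2r (ltW (w_gt0 n)) rP.
  have wwn : 0 <= 2 * (w n * w r) by rewrite ltW// !mulr_gt0.
  by move=> H1 /(ler_wpM2l wwn); lra.
have : c * w n / 2 <= H (n + r)%N (y N) - H n (y N) by lra.
rewrite Hrange => mid.
(* The r middle terms sum to at least c w_n / 2, while their total weight 2 (w_n - w_(n+r)) is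
   strictly below 2 w_n. *)
suff [i ig] : exists i : 'I_r, c / 4 <= g (n + i)%N (y N).
  have [k [nk kB hk]] := BP _ _ _ ig; exists k; split=> //.
    by apply: leq_trans nk; exact: leq_addr.
  by rewrite (bigD1 i)//= leq_max kB.
apply: contrapT => /forallNP all.
have : \sum_(i < r) w (n + i)%N * g (n + i)%N (y N) <= \sum_(i < r) w (n + i)%N * (c / 4).
  apply: ler_sum => i _; apply: ler_wpM2l; first exact: ltW.
  by rewrite leNgt; apply/negP => /ltW; exact: all.
have sumw s : \sum_(i < s) w (n + i)%N = 2 * (w n - w (n + s)%N).
  elim: s => [|s IH]; first by rewrite big_ord0 addn0 subrr mulr0.
  by rewrite big_ord_recr /= IH addnS wS; lra.
rewrite -mulr_suml sumw; have : 0 < c * w (n + r)%N by rewrite mulr_gt0.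
by lra.
Qed.

End Simons.

(** * Helly selection for box functionals *)

(** Sets outside U are replaced by the whole set; the first j + 1 sets then meet in an element of U,
    which contains arbitrarily large integers. *)
Lemma diagonal_sequence (I : countType) (U : set_system nat) (PU : ProperFilter U)
    (E : I -> set nat) : \oo `<=` U ->
  exists phi : nat -> nat, (forall j, (phi j < phi j.+1)%N) /\
    forall i, U (E i) -> exists K, forall j, (K <= j)%N -> E i (phi j).
Proof.
move=> Uoo; pose E' k := if unpickle k is Some i then
  (if `[< U (E i) >] then E i else setT) else setT.
have UE' k : U (E' k).
  rewrite /E'; case: unpickle => [i|]; last exact: filterT.
  by case: asboolP => // _; exact: filterT.
have UE'' j : U [set n | forall k, (k <= j)%N -> E' k n].
  elim: j => [|j IH].
    by apply: filterS (UE' 0) => n En k; rewrite leqn0 => /eqP ->.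
  apply: filterS (filterI IH (UE' j.+1)) => n [H1 H2] k.
  by rewrite leq_eqVlt => /predU1P[->//|]; exact: H1.
have /choice[pick pickP] (jm : nat * nat) : exists n, (jm.2 < n)%N /\
    forall k, (k <= jm.1)%N -> E' k n.
  have Um : U [set n | (jm.2 < n)%N] by apply: Uoo; exists jm.2.+1.
  by have [n [n1 n2]] := filter_ex (filterI Um (UE'' jm.1)); exists n.
pose phi := fix phi j := if j is j'.+1 then pick (j, phi j') else pick (0, 0)%N.
exists phi; split=> [j|i Ui]; first by have [] := pickP (j.+1, phi j).
exists (pickle i) => j ij.
have : E' (pickle i) (phi j).
  by case: j ij => [|j] ij; [have [_] := pickP (0, 0)%N|have [_] := pickP (j.+1, phi j)]; exact.
by rewrite /E' pickleK asboolT.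
Qed.

Lemma countable_sub_range (T : pointedType) (D : set T) : countable D ->
  exists q : nat -> T, D `<=` range q.
Proof.
move=> /countable_injP[f finj].
exists (fun n => xget point [set x | D x /\ f x = n]) => x Dx.
exists (f x) => //; case: xgetP => [y -> [Dy fyx]|/(_ x)]; last by case.
by apply: finj => //; rewrite inE.
Qed.

Lemma uniq_seq_separated (R : realType) (s : seq R) : uniq s ->
  exists2 delta : R, 0 < delta &
    forall x y, x \in s -> y \in s -> x != y -> delta <= `|x - y|.
Proof.
elim: s => [_|x s IH /= /andP[xs /IH[delta delta0 H]]]; first by exists 1.
have [eta eta0 Heta] : exists2 eta : R, 0 < eta & forall y, y \in s -> eta <= `|x - y|.
  elim: s xs {IH H} => [_|y s IH]; first by exists 1.
  rewrite inE negb_or => /andP[xy /IH[eta eta0 H]].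
  exists (Num.min eta `|x - y|); first by rewrite lt_min eta0 normr_gt0 subr_eq0.
  by move=> z; rewrite inE ge_min => /predU1P[->|/H ->//]; rewrite lexx orbT.
exists (Num.min delta eta); first by rewrite lt_min delta0.
move=> y z; rewrite !inE ge_min => /predU1P[->|ys] /predU1P[->|zs] yz.
- by rewrite eqxx in yz.
- by rewrite (Heta z)// orbT.
- by rewrite distrC (Heta y)// orbT.
- by rewrite H.
Qed.

Section Helly.
Context (R : realType) (d : nat) (Omega : set 'rV[R]_d.+1).
Local Notation Rd := 'rV[R]_d.+1.
Variables (nu : nat -> Rd * Rd -> R) (C : R).
Hypothesis nu_bounded : forall n p, box_in Omega p -> `|nu n p| <= C.
Hypothesis nu_cut : forall n (a b : Rd) i s, box_in Omega (a, b) ->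
  a 0 i <= s <= b 0 i ->
  nu n (a, b) = nu n (a, row_set b i s) + nu n (row_set a i s, b).
Hypothesis nu_few : forall eps : R, 0 < eps -> exists P : nat, forall n (p : nat -> Rd * Rd),
  (forall j, (j < P)%N -> box_in Omega (p j)) ->
  (forall i j, (i < P)%N -> (j < P)%N -> i != j ->
     parallelepiped (p i).1 (p i).2 `&` parallelepiped (p j).1 (p j).2 = set0) ->
  exists2 j, (j < P)%N & `|nu n (p j)| < eps.

Definition proper_box (p : Rd * Rd) :=
  box_in Omega p /\ forall i, p.1 0 i < p.2 0 i.

Section Ultra.
Context (U : set_system nat) (UU : UltraFilter U).

(** The analogue of a jump of size [eps] in Helly's theorem for monotone functions: mass persisting
    on boxes whose side in direction [i] concentrates at the point. *)
Definition bad_point (i : 'I_d.+1) (eps : R) : set R :=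
  [set s | forall delta, 0 < delta -> U [set n | exists p, [/\ proper_box p,
     s - delta < p.1 0 i, p.2 0 i < s + delta & eps <= `|nu n p|]]].

(** Finitely many bad points have a common index n with a heavy box near each. Their sides in
    direction [i] lie in disjoint intervals, so the boxes are disjoint, and [nu_few] bounds their
    number. *)
Lemma finite_bad_point i eps : 0 < eps -> finite_set (bad_point i eps).
Proof.
move=> eps0; apply: contrapT => /infinite_set_fset bad.
have [P HP] := nu_few eps0.
have [B Bbad PB] := bad P.
pose s : seq R := finmap.enum_fset B.
have us : uniq s by exact: finmap.fset_uniq.
have [delta delta0 sep] := uniq_seq_separated us.
have d2 : 0 < delta / 2 by lra.
have memP j : (j < P)%N -> nth 0 s j \in s by move=> jP; rewrite mem_nth// (leq_trans jP PB).
have UP m : (m <= P)%N -> U [set n | forall j, (j < m)%N -> exists p, [/\ proper_box p,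
    nth 0 s j - delta / 2 < p.1 0 i, p.2 0 i < nth 0 s j + delta / 2 & eps <= `|nu n p|]].
  elim: m => [_|m IH mP]; first by apply: filterS filterT => n _ j.
  have := Bbad _ (memP m mP) _ d2.
  move=> /filterI /(_ (IH (ltnW mP))); apply: filterS => n [H1 H2] j.
  by rewrite ltnS leq_eqVlt => /predU1P[->//|]; exact: H2.
have [n nP] := filter_ex (UP P (leqnn P)).
have /choice[p pP] j : exists p, (j < P)%N -> [/\ proper_box p,
    nth 0 s j - delta / 2 < p.1 0 i, p.2 0 i < nth 0 s j + delta / 2 & eps <= `|nu n p|].
  have [jP|jP] := ltnP j P; last by exists (0, 0).
  by have [p pP] := nP j jP; exists p.
have [j /pP[_ _ _ ej] je] : exists2 j, (j < P)%N & `|nu n (p j)| < eps.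
  apply: HP => [j /pP[[]]//|j k jP kP jk].
  have [_ j1 j2 _] := pP j jP; have [_ k1 k2 _] := pP k kP.
  have : delta <= `|nth 0 s j - nth 0 s k|.
    by apply: sep; rewrite ?memP// nth_uniq// (leq_trans _ PB).
  rewrite leNgt => /negP far; apply/seteqP; split=> // x [xj xk]; apply: far.
  have /andP[? ?] := xj i; have /andP[? ?] := xk i.
  by rewrite ltr_norml; lra.
by move: je; rewrite ltNge ej.
Qed.

Lemma separating_set : exists q : nat -> R, (forall x y, x < y -> exists k, x < q k < y) /\
  forall i eps, 0 < eps -> bad_point i eps `<=` range q.
Proof.
pose F (o : option ('I_d.+1 * nat)) : set R :=
  if o is Some ik then bad_point ik.1 ik.2.+1%:R^-1 else range (@ratr R).
have /countable_sub_range[q qD] : countable (\bigcup_o F o).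
  apply: bigcup_countable => // -[[i k]|] _ /=.
    by apply/finite_set_countable/finite_bad_point; rewrite invr_gt0.
  by apply: sub_countable (card_image_le _ _) _; exact: countableP.
exists q; split=> [x y /rat_in_itvoo[r]|i eps eps0 s sbad].
  rewrite in_itv /= => xry; have /qD[k _ kr] : (\bigcup_o F o) (ratr r) by exists None => //; exists r.
  by exists k; rewrite kr.
apply: qD; exists (Some (i, Num.truncn eps^-1)) => //= delta /sbad.
apply: filterS => n [p [pP p1 p2 pe]]; exists p; split=> //.
apply: le_trans pe; rewrite -[leRHS]invrK lef_pV2 ?posrE ?invr_gt0//.
by apply: ltW; exact: truncnS_gt.
Qed.

End Ultra.

(** The subsequence follows U on the countably many boxes with corner coordinates in [range q]. Any
    other coordinate is not bad, so moving it to a nearby [q k] costs only the value on a thin box,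
    small along the subsequence. *)
Lemma helly_selection : exists phi : nat -> nat, (forall j, (phi j < phi j.+1)%N) /\
  forall p, proper_box p -> forall eps, 0 < eps -> exists K, forall j k,
    (K <= j)%N -> (K <= k)%N -> `|nu (phi j) p - nu (phi k) p| < eps.
Proof.
have [U [UU Uoo]] := free_ultrafilter.
have [q [q_dense q_bad]] := separating_set UU.
have /choice[L LP] p : exists l : R, box_in Omega p -> nu n p @[n --> U] --> l.
  have [pO|pO] := pselect (box_in Omega p); last by exists 0.
  by have [l lP] := ultra_bounded_cvg UU (fun n => nu_bounded n pO); exists l.
pose I : countType := ((('rV[nat]_d.+1 * 'rV[nat]_d.+1) * nat) + ('I_d.+1 * nat * nat * nat))%type.
(* Two kinds of conditions: closeness to the U-limit on a grid box, and smallness on all boxes whose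
   side in direction [i] lies between [q k] and [q l]. *)
pose E (x : I) : set nat := match x with
  | inl (A, B, m) => [set n | `|nu n (map_mx q A, map_mx q B) - L (map_mx q A, map_mx q B)| < m.+1%:R^-1]
  | inr (i, k, l, m) => [set n | forall p, proper_box p -> q k <= p.1 0 i -> p.2 0 i <= q l ->
      `|nu n p| < m.+1%:R^-1]
  end.
have [phi [phiS phiE]] := diagonal_sequence _ E Uoo.
exists phi; split=> //.
have small (eps : R) : 0 < eps -> exists m : nat, m.+1%:R^-1 <= eps.
  move=> eps0; exists (Num.truncn eps^-1); rewrite -[leRHS]invrK lef_pV2 ?posrE ?invr_gt0//.
  by apply: ltW; exact: truncnS_gt.
have good i x eps : 0 < eps -> ~ range q x -> exists2 delta, 0 < delta & exists K, forall j, (K <= j)%N ->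
    forall p, proper_box p -> x - delta < p.1 0 i -> p.2 0 i < x + delta -> `|nu (phi j) p| < eps.
  move=> eps0 qx; have [m me] := small eps eps0.
  have m0 : 0 < m.+1%:R^-1 :> R by rewrite invr_gt0.
  have /existsNP[delta /not_implyP[delta0 nU]] : ~ bad_point U i m.+1%:R^-1 x.
    by move=> /(q_bad i _ m0).
  have {}nU : U (~` [set n | exists p, [/\ proper_box p, x - delta < p.1 0 i,
      p.2 0 i < x + delta & m.+1%:R^-1 <= `|nu n p|]]).
    by case: (in_ultra_setVsetC [set n | exists p, [/\ proper_box p, x - delta < p.1 0 i,
      p.2 0 i < x + delta & m.+1%:R^-1 <= `|nu n p|]] UU).
  have [k /andP[k1 k2]] : exists k, x - delta < q k < x by apply: q_dense; lra.
  have [l /andP[l1 l2]] : exists l, x < q l < x + delta by apply: q_dense; lra.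
  have [|K KP] := phiE (inr (i, k, l, m)).
    apply: filterS nU => n nP p pP p1 p2; rewrite ltNge; apply/negP => mp.
    by apply: nP; exists p; split=> //; [exact: lt_le_trans p1|exact: le_lt_trans l2].
  exists (Num.min (x - q k) (q l - x)); first by rewrite lt_min !subr_gt0 k2 l1.
  exists K => j Kj p pP p1 p2; apply: lt_le_trans me; apply: (KP j Kj p pP).
    have : Num.min (x - q k) (q l - x) <= x - q k by rewrite ge_min lexx.
    by lra.
  have : Num.min (x - q k) (q l - x) <= q l - x by rewrite ge_min lexx orbT.
  by lra.
have row_setE (a : Rd) i s j : row_set a i s 0 j = if j == i then s else a 0 j by rewrite mxE.
have shrink_a (a b : Rd) i s : proper_box (a, b) -> a 0 i <= s < b 0 i -> proper_box (row_set a i s, b).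
  move=> [abO ab] /andP[as_ sb]; split=> [x xab|j] /=.
    apply: abO => j; have := xab j; rewrite row_setE; case: eqVneq => // -> /andP[sx ->].
    by rewrite andbT (le_lt_trans as_).
  by rewrite row_setE; case: eqVneq => [->//|_]; exact: ab.
have shrink_b (a b : Rd) i s : proper_box (a, b) -> a 0 i < s <= b 0 i -> proper_box (a, row_set b i s).
  move=> [abO ab] /andP[as_ sb]; split=> [x xab|j] /=.
    apply: abO => j; have := xab j; rewrite row_setE; case: eqVneq => // -> /andP[-> xs] /=.
    exact: lt_le_trans sb.
  by rewrite row_setE; case: eqVneq => [->//|_]; exact: ab.
have row_set_id (a : Rd) i : row_set a i (a 0 i) = a.
  by apply/rowP => j; rewrite mxE; case: eqVneq => // ->.
(* A coordinate already in [range q] stays, since it may be bad. Any other is moved inwards, which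
   keeps the box inside [Omega]. *)
have move_a (a b : Rd) i eps : proper_box (a, b) -> 0 < eps -> exists s, [/\ range q s,
    proper_box (row_set a i s, b) & exists K, forall j, (K <= j)%N ->
      `|nu (phi j) (a, b) - nu (phi j) (row_set a i s, b)| < eps].
  move=> abP eps0; have [qa|qa] := pselect (range q (a 0 i)).
    by exists (a 0 i); rewrite row_set_id; split=> //; exists 0%N => j _; rewrite subrr normr0.
  have [delta delta0 [K KP]] := good i _ _ eps0 qa.
  have ai := abP.2 i; rewrite /= in ai.
  have [k /andP[k1 k2]] : exists k, a 0 i < q k < Num.min (a 0 i + delta) (b 0 i).
    by apply: q_dense; rewrite lt_min ai ltrDl delta0.
  move: k2; rewrite lt_min => /andP[k2 k3].
  exists (q k); split; [by exists k|by apply: shrink_a => //; rewrite k3 ltW|].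
  exists K => j Kj; rewrite (nu_cut (phi j) (s := q k) (i := i) abP.1); last by rewrite !ltW.
  rewrite addrK; apply: (KP j Kj (a, row_set b i (q k))) => /=.
  - by apply: shrink_b => //; rewrite k1 ltW.
  - by rewrite ltrBlDr ltrDl.
  - by rewrite row_setE eqxx.
have move_b (a b : Rd) i eps : proper_box (a, b) -> 0 < eps -> exists s, [/\ range q s,
    proper_box (a, row_set b i s) & exists K, forall j, (K <= j)%N ->
      `|nu (phi j) (a, b) - nu (phi j) (a, row_set b i s)| < eps].
  move=> abP eps0; have [qb|qb] := pselect (range q (b 0 i)).
    by exists (b 0 i); rewrite row_set_id; split=> //; exists 0%N => j _; rewrite subrr normr0.
  have [delta delta0 [K KP]] := good i _ _ eps0 qb.
  have ai := abP.2 i; rewrite /= in ai.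
  have [k /andP[k1 k2]] : exists k, Num.max (b 0 i - delta) (a 0 i) < q k < b 0 i.
    by apply: q_dense; rewrite gt_max ai andbT ltrBlDr ltrDl.
  move: k1; rewrite gt_max => /andP[k1 k3].
  exists (q k); split; [by exists k|by apply: shrink_b => //; rewrite k3 ltW|].
  exists K => j Kj; rewrite (nu_cut (phi j) (s := q k) (i := i) abP.1); last by rewrite !ltW.
  rewrite addrC addKr; apply: (KP j Kj (row_set a i (q k), b)) => /=.
  - by apply: shrink_a => //; rewrite k2 ltW.
  - by rewrite row_setE eqxx.
  - by rewrite ltrDl.
have moves_a (s : seq 'I_d.+1) (a b : Rd) eps : proper_box (a, b) -> 0 < eps -> exists a' : Rd,
    [/\ forall i, i \in s -> range q (a' 0 i), proper_box (a', b) &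
      exists K, forall j, (K <= j)%N -> `|nu (phi j) (a, b) - nu (phi j) (a', b)| < eps].
  move=> abP; elim: s eps => [|i s IH] eps eps0.
    by exists a; split=> //; exists 0%N => j _; rewrite subrr normr0.
  have e2 : 0 < eps / 2 by lra.
  have [a1 [a1q a1P [K1 H1]]] := IH _ e2.
  have [t [tq tP [K2 H2]]] := move_a a1 b i _ a1P e2.
  exists (row_set a1 i t); split=> // [j|].
    by rewrite inE row_setE; case: eqVneq => //= _; exact: a1q.
  exists (maxn K1 K2) => j; rewrite geq_max => /andP[/H1 + /H2].
  by rewrite !ltr_norml; lra.
have moves_b (s : seq 'I_d.+1) (a b : Rd) eps : proper_box (a, b) -> 0 < eps -> exists b' : Rd,
    [/\ forall i, i \in s -> range q (b' 0 i), proper_box (a, b') &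
      exists K, forall j, (K <= j)%N -> `|nu (phi j) (a, b) - nu (phi j) (a, b')| < eps].
  move=> abP; elim: s eps => [|i s IH] eps eps0.
    by exists b; split=> //; exists 0%N => j _; rewrite subrr normr0.
  have e2 : 0 < eps / 2 by lra.
  have [b1 [b1q b1P [K1 H1]]] := IH _ e2.
  have [t [tq tP [K2 H2]]] := move_b a b1 i _ b1P e2.
  exists (row_set b1 i t); split=> // [j|].
    by rewrite inE row_setE; case: eqVneq => //= _; exact: b1q.
  exists (maxn K1 K2) => j; rewrite geq_max => /andP[/H1 + /H2].
  by rewrite !ltr_norml; lra.
(* Six errors: for each of the two indices, moving the lower corner, moving the upper corner, and
   the distance to the limit. *)
move=> [a b] abP eps eps0; have e6 : 0 < eps / 6 by lra.
have [a' [a'q a'P [K1 H1]]] := moves_a (enum 'I_d.+1) a b _ abP e6.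
have [b' [b'q b'P [K2 H2]]] := moves_b (enum 'I_d.+1) a' b _ a'P e6.
have /choice[fA fAP] i : exists k, q k = a' 0 i.
  by have [|k _ kE] := a'q i; [rewrite mem_enum|exists k].
have /choice[fB fBP] i : exists k, q k = b' 0 i.
  by have [|k _ kE] := b'q i; [rewrite mem_enum|exists k].
have aE : a' = map_mx q (\row_i fA i) by apply/rowP => i; rewrite !mxE fAP.
have bE : b' = map_mx q (\row_i fB i) by apply/rowP => i; rewrite !mxE fBP.
have [m me] := small _ e6.
have [|K3 H3] := phiE (inl (\row_i fA i, \row_i fB i, m)).
  rewrite /E -aE -bE; have /cvgr_dist_lt : nu n (a', b') @[n --> U] --> L (a', b') by apply: LP; exact: b'P.1.
  move=> /(_ m.+1%:R^-1); rewrite invr_gt0 ltr0n => /(_ isT).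
  by apply: filterS => n; rewrite distrC.
rewrite /E -aE -bE in H3.
exists (maxn K1 (maxn K2 K3)) => j k.
rewrite !geq_max => /andP[/H1 + /andP[/H2 + /H3 /= +]] /andP[/H1 + /andP[/H2 + /H3 /= +]].
move: me; set y := _^-1; set x := L _; rewrite !ltr_norml.
by lra.
Qed.

End Helly.

(** * The James norm *)

Lemma sum_split_if (V : nmodType) (m n : nat) (F : nat -> V) : (m <= n)%N ->
  \sum_(i < n) F i = \sum_(i < m) F i + \sum_(i < n) (if (m <= i)%N then F i else 0).
Proof.
move=> mn; rewrite -sum_nat_if -(big_mkord xpredT F) (big_cat_nat (leq0n m) mn).
by rewrite /= big_mkord.
Qed.

Section JamesNorm.
Context (R : realType) (d : nat) (X : completeNormedModType R) (e : nat -> X).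
Hypotheses (e_basis : schauder_basis e) (e_symmetric : one_symmetric e).
Hypothesis X_reflexive : reflexive_space X.
Context (Omega : set 'rV[R]_d.+1).
Hypotheses (Omega_open : open Omega) (Omega_bounded : bounded_set Omega).
Local Notation Rd := 'rV[R]_d.+1.
Local Notation Ld := (lebesgue_space R d).

Definition disjoint_boxes (p : nat -> Rd * Rd) := forall i j, i != j ->
  parallelepiped (p i).1 (p i).2 `&` parallelepiped (p j).1 (p j).2 = set0.

Lemma parallelepiped0 : parallelepiped (0 : Rd) 0 = set0.
Proof.
apply/seteqP; split=> // x /(_ 0) /andP[x0] /(lt_trans x0).
by rewrite ltxx.
Qed.

(** The James norm only tests nondegenerate boxes; empty ones carry the coefficient 0 and are
    deleted by [norm_sum_compress]. *)
Lemma JF_norm_ge (f : Ld -> R) (M : nat) (p : nat -> Rd * Rd) :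
  (forall j, box_in Omega (p j)) -> disjoint_boxes p ->
  (`|\sum_(j < M) box_integral f (p j) *: e j|%:E <= JF_norm e Omega f)%E.
Proof.
move=> pO p0; rewrite (norm_sum_compress e_symmetric M (fun j => box_integral f (p j))).
set s := [seq _ <- _ | _].
have us : uniq s by rewrite filter_uniq ?iota_uniq.
apply: ereal_sup_ubound; exists (size s).
exists (fun j => parallelepiped (p (nth 0%N s j)).1 (p (nth 0%N s j)).2); split=> //.
- move=> j js; split; first exact: pO.
  exists (p (nth 0%N s j)).1, (p (nth 0%N s j)).2; split=> // i.
  have : nth 0%N s j \in s by exact: mem_nth.
  rewrite mem_filter => /andP[+ _]; apply: contraNT; rewrite -leNgt => ba.
  apply/eqP/box_integral_empty/seteqP; split=> // x /(_ i) /andP[ax xb].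
  by have := lt_le_trans (lt_trans ax xb) ba; rewrite ltxx.
- apply/trivIsetP => i j /= ism jsm ij; apply: p0; by rewrite nth_uniq.
Qed.

Lemma JF_norm_gt (f : Ld -> R) (c : R) : (c%:E < JF_norm e Omega f)%E ->
  exists (m : nat) (p : nat -> Rd * Rd), [/\
    forall j, (j < m)%N -> proper_box Omega (p j),
    forall j, (m <= j)%N -> p j = (0, 0),
    disjoint_boxes p &
    c < `|\sum_(j < m) box_integral f (p j) *: e j|].
Proof.
move=> /ereal_sup_gt[_ [m [T [TO T0 ->]]]]; rewrite lte_fin => cT.
have /choice[p pP] j : exists p : Rd * Rd, ((j < m)%N -> proper_box Omega p /\
    T j = parallelepiped p.1 p.2) /\ ((m <= j)%N -> p = (0, 0)).
  have [jm|mj] := ltnP j m; last by exists (0, 0).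
  have [TjO [a [b [ab Tj]]]] := TO j jm.
  by exists (a, b); split=> // _; split=> //; split=> //; rewrite /box_in -Tj.
have pT j : (j < m)%N -> parallelepiped (p j).1 (p j).2 = T j.
  by move=> jm; have [/(_ jm)[_ ->]] := pP j.
have pE j : (m <= j)%N -> p j = (0, 0) by have [] := pP j.
exists m, p; split=> //.
- by move=> j jm; have [/(_ jm)[]] := pP j.
- move=> i j ij; have [im|/pE ->] := ltnP i m; last by rewrite parallelepiped0 set0I.
  have [jm|/pE ->] := ltnP j m; last by rewrite parallelepiped0 setI0.
  by rewrite !pT//; exact: (trivIsetP.1 T0).
- rewrite (eq_bigr (fun j : 'I_m => (\int[@lebesgue R d]_(x in T j) f x) *: e j))// => j _.
  by rewrite /box_integral pT.
Qed.

(* The functionals sum_(j < m) b_j * (int over p_j), with (b_j) in the unit ball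
   of the dual of X and arranged in decreasing order, norm the space JF. *)
Definition test_system (t : nat * (nat -> R) * (nat -> Rd * Rd)) := [/\
  bstar e t.1.2,
  forall i j, (i <= j)%N -> (j < t.1.1)%N -> `|t.1.2 j| <= `|t.1.2 i|,
  forall j, (j < t.1.1)%N -> proper_box Omega (t.2 j),
  forall j, (t.1.1 <= j)%N -> t.2 j = (0, 0) &
  disjoint_boxes t.2].

Definition test_value (f : Ld -> R) (t : nat * (nat -> R) * (nat -> Rd * Rd)) :=
  \sum_(j < t.1.1) t.1.2 j * box_integral f (t.2 j).

Lemma test_system_box_in t : test_system t -> forall j, box_in Omega (t.2 j).
Proof.
case=> _ _ tO t0 _ j; have [/tO[]//|/t0 ->] := ltnP j t.1.1.
by rewrite /box_in parallelepiped0.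
Qed.

Lemma test_value_le f t : test_system t ->
  (`|test_value f t|%:E <= JF_norm e Omega f)%E.
Proof.
move=> tP; have [tb _ _ _ t0] := tP.
apply: le_trans (JF_norm_ge f t.1.1 (test_system_box_in tP) t0).
by rewrite lee_fin; exact: (bstar_abs t.1.1 (fun j => box_integral f (t.2 j)) tb).
Qed.

Lemma test_value_norming f (c : R) : (c%:E < JF_norm e Omega f)%E ->
  exists t, test_system t /\ c < test_value f t.
Proof.
move=> /JF_norm_gt[m [p [pm p0 pd cp]]].
have [b bP bx] := bstar_norming e_symmetric m (fun j => box_integral f (p j)).
pose r i j := `|b j| <= `|b i|.
have r_total : total r by move=> i j; rewrite /r; exact: le_total.
have r_trans : transitive r by move=> i j k; rewrite /r => ? /le_trans; apply.
have r_refl : reflexive r by move=> i; rewrite /r.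
(* Sorting the indices by decreasing modulus of [b] permutes coefficients and boxes together, so the
   value is unchanged. *)
pose s := sort r (iota 0 m).
have ssz : size s = m by rewrite size_sort size_iota.
have us : uniq s by rewrite sort_uniq iota_uniq.
have sm j : (j < m)%N -> (nth 0%N s j < m)%N.
  move=> jm; have : nth 0%N s j \in s by rewrite mem_nth// ssz.
  by rewrite mem_sort mem_iota.
pose b' i := if (i < size s)%N then b (nth 0%N s i) else 0.
pose p' i := if (i < m)%N then p (nth 0%N s i) else (0, 0).
exists (m, b', p'); split; last first.
  rewrite /test_value /=; apply: (lt_le_trans cp); apply: (le_trans bx).
  rewrite le_eqVlt; apply/orP; left; apply/eqP.
  rewrite -(big_mkord xpredT (fun i => b i * box_integral f (p i))) /index_iota subn0.
  rewrite (perm_big s) /=; last by rewrite perm_sym perm_sort.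
  rewrite (big_nth 0%N) ssz big_mkord; apply: eq_bigr => i _.
  by rewrite /b' /p' ssz ltn_ord.
split=> /=.
- exact: bstar_uniq_seq.
- move=> i j ij jm; rewrite /b' ssz jm (leq_ltn_trans ij jm).
  by apply: (sorted_leq_nth r_trans r_refl 0%N (sort_sorted r_total (iota 0 m)));
    rewrite ?inE ?ssz// (leq_ltn_trans ij jm).
- by move=> j jm; rewrite /p' jm; apply/pm/sm.
- by move=> j mj; rewrite /p' ltnNge mj.
- move=> i j ij; rewrite /p'; case: ltnP => im; last by rewrite parallelepiped0 set0I.
  case: ltnP => jm; last by rewrite parallelepiped0 setI0.
  by apply: pd; rewrite nth_uniq// ssz.
Qed.

(** Corners need not lie in [Omega]. A corner coordinate beyond [M] would leave interior points of
    the box with that coordinate beyond [M]. *)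
Lemma proper_box_bounded : exists M : R, forall p, proper_box Omega p ->
  forall i, `|p.1 0 i| <= M /\ `|p.2 0 i| <= M.
Proof.
have [M M0 OM] := bounded_coord Omega_bounded; exists M => p [pO pp] i.
have inM t : p.1 0 i < t < p.2 0 i -> `|t| < M.
  move=> tp; pose x : Rd := row_set (\row_j ((p.1 0 j + p.2 0 j) / 2)) i t.
  have <- : x 0 i = t by rewrite mxE eqxx.
  apply/OM/pO => j; rewrite !mxE; case: eqVneq => [->//|_].
  by have := pp j; lra.
have pi := pp i.
have aM : - M <= p.1 0 i.
  rewrite leNgt; apply/negP => aM.
  have := inM ((p.1 0 i + Num.min (p.2 0 i) (- M)) / 2).
  have : Num.min (p.2 0 i) (- M) <= p.2 0 i by rewrite ge_min lexx.
  have : Num.min (p.2 0 i) (- M) <= - M by rewrite ge_min lexx orbT.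
  have : p.1 0 i < Num.min (p.2 0 i) (- M) by rewrite lt_min pi.
  move=> h1 h2 h3 H; have : `|(p.1 0 i + Num.min (p.2 0 i) (- M)) / 2| < M by apply: H; lra.
  by rewrite ltr_norml; lra.
have bM : p.2 0 i <= M.
  rewrite leNgt; apply/negP => bM.
  have := inM ((p.2 0 i + Num.max (p.1 0 i) M) / 2).
  have : p.1 0 i <= Num.max (p.1 0 i) M by rewrite le_max lexx.
  have : M <= Num.max (p.1 0 i) M by rewrite le_max lexx orbT.
  have : Num.max (p.1 0 i) M < p.2 0 i by rewrite gt_max pi.
  move=> h1 h2 h3 H; have : `|(p.2 0 i + Num.max (p.1 0 i) M) / 2| < M by apply: H; lra.
  by rewrite ltr_norml; lra.
by rewrite !ler_norml; lra.
Qed.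

Section Limit.
Variables (g : nat -> Ld -> R) (C : R).
Hypothesis g_L1 : forall k, L1 Omega (g k).
Hypothesis g_bounded : forall k, (JF_norm e Omega (g k) <= C%:E)%E.
Hypothesis g_null : forall p, proper_box Omega p -> forall eps : R, 0 < eps ->
  exists K, forall k, (K <= k)%N -> `|box_integral (g k) p| < eps.

(* The pointwise limit of test systems is again given by a sequence (b_j) in the
   unit ball of the dual of X and by disjoint, possibly empty, boxes: since the
   b_j are in decreasing order, they are uniformly small for large j and the L^1
   norm of g_k controls the tail. As the basis of X is shrinking, such a limit
   functional takes small values at g_k for large k. *)
Lemma test_value_limit (U : set_system nat) (t : nat -> nat * (nat -> R) * (nat -> Rd * Rd))
    (eps : R) : UltraFilter U -> (forall N, test_system (t N)) -> 0 < eps ->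
  exists K, forall k, (K <= k)%N -> U [set N | test_value (g k) (t N) < eps].
Proof.
move=> UU tP eps0.
have C0 : 0 <= C.
  have := test_value_le (g 0) (tP 0); rewrite -lee_fin => /le_trans H.
  by apply: le_trans (H _ (g_bounded 0)); rewrite lee_fin.
have /choice[b bP] j : exists l : R, (t N).1.2 j @[N --> U] --> l.
  by apply: (ultra_bounded_cvg UU) => N; have [tb _ _ _ _] := tP N; exact: bstar_le tb.
have bstarb : bstar e b.
  by apply: (bstar_lim (U := U)) bP => N; have [] := tP N.
have [M MP] := proper_box_bounded.
have tM N j i : `|((t N).2 j).1 0 i| <= `|M| /\ `|((t N).2 j).2 0 i| <= `|M|.
  have [_ _ tO t0 _] := tP N; have [/tO/MP/(_ i)[h1 h2]|/t0 ->] := ltnP j (t N).1.1.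
    by split; apply: le_trans (ler_norm M).
  by rewrite /= !mxE normr0.
have /choice[a1 a1P] (ji : nat * 'I_d.+1) : exists l : R, ((t N).2 ji.1).1 0 ji.2 @[N --> U] --> l.
  by apply: (ultra_bounded_cvg UU) => N; exact: (tM N ji.1 ji.2).1.
have /choice[a2 a2P] (ji : nat * 'I_d.+1) : exists l : R, ((t N).2 ji.1).2 0 ji.2 @[N --> U] --> l.
  by apply: (ultra_bounded_cvg UU) => N; exact: (tM N ji.1 ji.2).2.
pose p j : Rd * Rd := (\row_i a1 (j, i), \row_i a2 (j, i)).
(* Strict inequalities at the limit hold for U-many N; inclusion in [Omega] and disjointness thus
   pass to the limit boxes, which may be empty. *)
have pin j x : parallelepiped (p j).1 (p j).2 x ->
    U [set N | parallelepiped ((t N).2 j).1 ((t N).2 j).2 x].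
  move=> xp; apply: filter_forall => i; have /andP[x1 x2] := xp i.
  rewrite !mxE in x1 x2.
  have h1 : U [set N | ((t N).2 j).1 0 i < x 0 i] by exact: (cvgr_lt _ (a1P (j, i)) _ x1).
  have h2 : U [set N | x 0 i < ((t N).2 j).2 0 i] by exact: (cvgr_gt _ (a2P (j, i)) _ x2).
  by apply: (@filterS _ U _ _ _ _ (filterI h1 h2)) => N [/= -> ->].
have pO j : box_in Omega (p j).
  by move=> x /pin /filter_ex[N /(test_system_box_in (tP N))].
have pd : disjoint_boxes p.
  move=> i j ij; apply/seteqP; split=> // x [/pin xi /pin xj].
  have [N [Ni Nj]] := filter_ex (filterI xi xj).
  by have [_ _ _ _ /(_ _ _ ij)] := tP N; move=> /seteqP[+ _] => /(_ x); exact.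
have eps1 : 0 < eps / (4 * (C + 1)) by rewrite divr_gt0// mulr_gt0//; lra.
have [m mP] := bstar_tail e_basis e_symmetric X_reflexive bstarb eps1.
(* [K] depends only on the first m limit boxes; the other boxes of the limit are controlled by
   [bstar_tail] and the uniform bound [C]. *)
have [K KP] : exists K, forall k, (K <= k)%N ->
    \sum_(j < m) b j * box_integral (g k) (p j) < eps / 4.
  have eps4 : 0 < eps / 4 by lra.
  elim: {mP} m (eps / 4) eps4 => [|m IH] eta eta0.
    by exists 0%N => k _; rewrite big_ord0.
  have eta2 : 0 < eta / 2 by lra.
  have [K1 H1] := IH _ eta2.
  have [K2 H2] : exists K, forall k, (K <= k)%N -> b m * box_integral (g k) (p m) < eta / 2.
    have [pm|npm] := pselect (proper_box Omega (p m)); last first.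
      exists 0%N => k _; rewrite box_integral_empty ?mulr0//.
      apply/seteqP; split=> // x xp; apply: npm; split=> // i.
      by have /andP[h1 h2] := xp i; exact: lt_trans h2.
    have bm0 : 0 < `|b m| + 1 by rewrite ltr_wpDl.
    have [|K H] := g_null pm (eps := eta / 2 / (`|b m| + 1)); first by rewrite divr_gt0.
    exists K => k /H; rewrite ltr_pdivlMr// => Hk.
    apply: (le_lt_trans (ler_norm _)); rewrite normrM; apply: le_lt_trans Hk.
    by rewrite mulrC ler_wpM2l// lerDl.
  exists (maxn K1 K2) => k; rewrite geq_max => /andP[/H1 h1 /H2 h2].
  by rewrite big_ord_recr /=; lra.
exists K => k Kk.
(* Only now, with k fixed, is the L^1 norm used; the cutoff [L] below may depend on it since [K] is
   already chosen. *)
pose B := \int[@lebesgue R d]_(x in Omega) `|g k x|.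
have B0 : 0 <= B by apply: Rintegral_ge0.
have eta0 : 0 < eps / (4 * (B + 1)) by rewrite divr_gt0// mulr_gt0//; lra.
set eta := _ / _ in eta0.
have [L0 L0P] := bstar_large e_basis e_symmetric X_reflexive eta0.
pose L := maxn m L0.
have nu_cvg j : box_integral (g k) ((t N).2 j) @[N --> U] --> box_integral (g k) (p j).
  apply/cvgrPdist_lt => r r0.
  have [delta delta0 H] := box_integral_continuous Omega_open Omega_bounded (g_L1 k) r0.
  have : U [set N | forall i, `|a1 (j, i) - ((t N).2 j).1 0 i| < delta /\
      `|a2 (j, i) - ((t N).2 j).2 0 i| < delta].
    apply: filter_forall => i.
    have h1 : U [set N | `|a1 (j, i) - ((t N).2 j).1 0 i| < delta].
      by move/cvgrPdist_lt: (a1P (j, i)) => /(_ _ delta0).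
    have h2 : U [set N | `|a2 (j, i) - ((t N).2 j).2 0 i| < delta].
      by move/cvgrPdist_lt: (a2P (j, i)) => /(_ _ delta0).
    exact: filterI h1 h2.
  apply: filterS => N HN; apply: H => //; first exact: test_system_box_in.
  by move=> i; rewrite !mxE; have [/ltW ? /ltW ?] := HN i.
have sum_cvg : (\sum_(j < L) (t N).1.2 j * box_integral (g k) ((t N).2 j)) @[N --> U] -->
    \sum_(j < L) b j * box_integral (g k) (p j).
  elim: L => [|L' IH].
    by under eq_fun do rewrite big_ord0; rewrite big_ord0; exact: cvg_cst.
  under eq_fun do rewrite big_ord_recr; rewrite big_ord_recr /=.
  by apply: cvgD => //; apply: cvgM.
have limit_small : \sum_(j < L) b j * box_integral (g k) (p j) < eps / 2.
  have -> : \sum_(j < L) b j * box_integral (g k) (p j) =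
     \sum_(j < m) b j * box_integral (g k) (p j) +
     \sum_(j < L) b j * (if (m <= j)%N then box_integral (g k) (p j) else 0).
    rewrite (sum_split_if (fun j => b j * box_integral (g k) (p j)) (leq_maxl m L0)).
    by congr (_ + _); apply: eq_bigr => j _; case: ifP; rewrite ?mulr0.
  have tl := mP L (fun j => if (m <= j)%N then box_integral (g k) (p j) else 0).
  have {}tl : \sum_(j < L) b j * (if (m <= j)%N then box_integral (g k) (p j) else 0)
      <= eps / (4 * (C + 1)) * C.
    apply: (le_trans (tl _)) => [i im|]; first by rewrite leqNgt im.
    rewrite ler_pM2l//.
    apply: le_trans (norm_sum_restrict e_symmetric (fun j => m <= j)%N L (fun j => box_integral (g k) (p j))) _.
    rewrite -lee_fin; apply: le_trans (g_bounded k).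
    exact: JF_norm_ge.
  have : eps / (4 * (C + 1)) * C <= eps / 4.
    rewrite invfM mulrA -mulrA ler_piMr//; first lra.
    by rewrite ler_pdivrMl; lra.
  by have := KP k Kk; lra.
have eps4 : 0 < eps / 4 by lra.
move/cvgrPdist_lt: sum_cvg => /(_ _ eps4); apply: filterS => N /=.
rewrite ltr_norml => /andP[near1 _].
have [tb tdec _ t0 td] := tP N.
pose Q := maxn L (t N).1.1.
have -> : test_value (g k) (t N) = \sum_(j < L) (t N).1.2 j * box_integral (g k) ((t N).2 j) +
   \sum_(j < Q) (if (L <= j)%N then (t N).1.2 j * box_integral (g k) ((t N).2 j) else 0).
  pose F j := (t N).1.2 j * box_integral (g k) ((t N).2 j).
  rewrite -(sum_split_if F (leq_maxl L (t N).1.1)).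
  rewrite (sum_split_if F (leq_maxr L (t N).1.1)) [X in _ = _ + X]big1 ?addr0// => j _.
  case: leqP => // mj.
  by rewrite /F (t0 _ mj) box_integral_empty ?mulr0// parallelepiped0.
have : \sum_(j < Q) (if (L <= j)%N then (t N).1.2 j * box_integral (g k) ((t N).2 j) else 0)
   <= eta * B.
  apply: (@le_trans _ _ (\sum_(j < Q) eta * `|box_integral (g k) ((t N).2 j)|)); last first.
    rewrite -mulr_sumr ler_pM2l//.
    exact: (sum_norm_box_integral Omega_open (g_L1 k) Q (test_system_box_in (tP N)) td).
  apply: ler_sum => j _; case: leqP => Lj; last by rewrite mulr_ge0// ltW.
  have [jm|mj] := ltnP j (t N).1.1; last first.
    by rewrite (t0 _ mj) box_integral_empty ?normr0 ?mulr0// parallelepiped0.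
  apply: (le_trans (ler_norm _)); rewrite normrM ler_wpM2r//.
  (* By monotonicity, a coefficient above [eta] at j makes the first j + 1 coefficients exceed
     [eta], so j < L0 <= L. *)
  rewrite leNgt; apply/negP => bj.
  have := L0P _ tb (iota 0 j.+1) (iota_uniq _ _).
  rewrite size_iota => H; have : (j < L0)%N.
    apply: H => i; rewrite mem_iota add0n /= ltnS => ij.
    exact: lt_le_trans bj (tdec _ _ ij jm).
  by rewrite ltnNge (leq_trans (leq_maxr m L0) Lj).
have : eta * B <= eps / 4.
  rewrite /eta invfM mulrA -mulrA ler_piMr//; first lra.
  by rewrite ler_pdivrMl; lra.
by lra.
Qed.

End Limit.
End JamesNorm.

(** * Absence of l1 *)

Section NoL1.
Context (R : realType) (d : nat) (X : completeNormedModType R) (e : nat -> X).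
Hypotheses (e_basis : schauder_basis e) (e_symmetric : one_symmetric e).
Hypothesis X_reflexive : reflexive_space X.
Context (Omega : set 'rV[R]_d.+1).
Hypotheses (Omega_open : open Omega) (Omega_bounded : bounded_set Omega).
Local Notation Rd := 'rV[R]_d.+1.
Local Notation Ld := (lebesgue_space R d).

Lemma JF_convex_combination_small (g : nat -> Ld -> R) (C c : R) :
  (forall k, L1 Omega (g k)) -> (forall k, (JF_norm e Omega (g k) <= C%:E)%E) ->
  (forall p, proper_box Omega p -> forall eps : R, 0 < eps ->
    exists K, forall k, (K <= k)%N -> `|box_integral (g k) p| < eps) ->
  0 < c -> exists (N : nat) (l : nat -> R), [/\ forall k, 0 <= l k,
    \sum_(k < N) l k = 1 &
    (JF_norm e Omega (fun x => (\sum_(k < N) l k * g k x)%R) < c%:E)%E].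
Proof.
move=> gL gC g0 c0; apply: contrapT => /forallNP big.
pose G := {t : nat * (nat -> R) * (nat -> Rd * Rd) | test_system e Omega t}.
pose h k (t : G) := test_value (g k) (sval t).
have hC k t : `|h k t| <= C.
  rewrite -lee_fin; apply: le_trans (gC k); apply: (test_value_le e_symmetric).
  exact: svalP.
(* The empty test system provides the base point that [simons] asks for. *)
have t0P : test_system e Omega ((0%N, fun=> 0), fun=> (0, 0)).
  split=> //= [N x|i j ij].
    by rewrite big1// => i _; rewrite mul0r.
  by rewrite parallelepiped0 setI0.
pose x0 : G := exist _ _ t0P.
have hull_sup f : dyadic_hull h 0 f -> c <= fun_sup f.
  move=> hf; rewrite leNgt; apply/negP => fc.
  have [N [l [l0 l1 fE]]] := dyadic_hull_comb hf.
  have /forallNP/(_ l) nbig := big N.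
  have : (c%:E <= JF_norm e Omega (fun x => (\sum_(k < N) l k * g k x)%R))%E.
    by rewrite leNgt; apply/negP => lt; apply: nbig.
  move/(lt_le_trans (_ : ((fun_sup f)%:E < c%:E)%E)); rewrite lte_fin => /(_ fc).
  move=> /(test_value_norming e_symmetric)[t [tP ft]].
  have : f (exist _ t tP) <= fun_sup f.
    apply: ub_le_sup; last by exists (exist _ t tP).
    exists C => _ [y _ <-]; exact: le_trans (ler_norm _) (dyadic_hull_bounded hC hf y).
  rewrite leNgt fE; apply/negP/negPn.
  rewrite (_ : \sum_(k < N) _ = test_value (fun x => \sum_(k < N) l k * g k x) t)//.
  rewrite /h /test_value /=.
  rewrite (eq_bigr (fun k : 'I_N => \sum_(j < t.1.1) l k * (t.1.2 j * box_integral (g k) (t.2 j)))); last first.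
    by move=> k _; rewrite mulr_sumr.
  rewrite exchange_big /=; apply: eq_bigr => j _.
  rewrite (box_integral_sum Omega_open N l (@test_system_box_in _ _ _ _ _ _ tP j) gL) mulr_sumr.
  by apply: eq_bigr => k _; rewrite mulrCA.
have [y yP] := simons x0 hC c0 hull_sup.
have [U [UU Uoo]] := free_ultrafilter.
have c4 : 0 < c / 4 by lra.
have [K KP] := test_value_limit e_basis e_symmetric X_reflexive Omega_open Omega_bounded
  gL gC g0 UU (fun N => svalP (y N)) c4.
(* Starting at n = K leaves the finitely many k in [K, B), so the smallness of each [g k] holds
   simultaneously for U-many N, against the largeness of one of them. *)
have [B /Uoo UB] := yP K.
have UK : U [set N | forall k : 'I_B, (K <= k)%N -> test_value (g k) (sval (y N)) < c / 4].
  apply: filter_forall => k; have [Kk|kK] := leqP K k.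
    by apply: filterS (KP k Kk) => N.
  by apply: filterS filterT => N.
have [N [[k [Kk kB ck]] /(_ (Ordinal kB) Kk)]] := filter_ex (filterI UB UK).
by rewrite ltNge ck.
Qed.

Lemma JF_selection (f : nat -> Ld -> R) (C : R) :
  (forall n, L1 Omega (f n)) -> (forall n, (JF_norm e Omega (f n) <= C%:E)%E) ->
  exists phi : nat -> nat, (forall j, (phi j < phi j.+1)%N) /\
    forall p, proper_box Omega p -> forall eps, 0 < eps -> exists K, forall j k,
      (K <= j)%N -> (K <= k)%N ->
      `|box_integral (f (phi j)) p - box_integral (f (phi k)) p| < eps.
Proof.
move=> fL fC; have e0 := norm_basis_gt0 e_basis e_symmetric 0.
have sumC n M (p : nat -> Rd * Rd) : (forall j, (j < M)%N -> box_in Omega (p j)) ->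
    (forall i j, (i < M)%N -> (j < M)%N -> i != j ->
      parallelepiped (p i).1 (p i).2 `&` parallelepiped (p j).1 (p j).2 = set0) ->
    `|\sum_(j < M) box_integral (f n) (p j) *: e j| <= C.
  move=> pO p0; pose p' j := if (j < M)%N then p j else (0, 0).
  have -> : \sum_(j < M) box_integral (f n) (p j) *: e j =
      \sum_(j < M) box_integral (f n) (p' j) *: e j.
    by apply: eq_bigr => j _; rewrite /p' ltn_ord.
  rewrite -lee_fin; apply: le_trans (fC n); apply: (JF_norm_ge e_symmetric).
    move=> j; rewrite /p'; case: ltnP => [/pO//|_].
    by rewrite /box_in parallelepiped0.
  move=> i j ij; rewrite /p'; case: ltnP => iM; last by rewrite parallelepiped0 set0I.
  case: ltnP => jM; last by rewrite parallelepiped0 setI0.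
  exact: p0.
apply: (@helly_selection R d Omega (fun n p => box_integral (f n) p) (C / `|e 0|)).
- move=> n p pO; rewrite ler_pdivlMr// -normrZ.
  have := sumC n 1%N (fun=> p); rewrite big_ord1; apply=> // i j.
  by rewrite !ltnS !leqn0 => /eqP -> /eqP ->.
- move=> n a b i s abO asb.
  exact: (box_integral_cut Omega_open (fL n) abO asb).
- move=> eps eps0.
  (* By domination, [P] disjoint boxes with integrals at least [eps] would give norm at least [eps]
     times that of the sum of [P] basis vectors, hence more than [C]. *)
  have [P CP] := norm_sum_unbounded e_basis e_symmetric X_reflexive (C / eps).
  exists P => n p pO p0; apply: contrapT => nlt.
  have small : eps * `|\sum_(i < P) e i| <= C.
    apply: le_trans (sumC n P p pO p0).
    rewrite -[eps in leLHS](ger0_norm (ltW eps0)) -normrZ scaler_sumr.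
    apply: (ler_norm_basis_sum e_symmetric (x := fun i => box_integral (f n) (p i)) (y := fun=> eps)).
    move=> i iP; rewrite (ger0_norm (ltW eps0)) leNgt; apply/negP => lt.
    by apply: nlt; exists i.
  by move: CP; rewrite ltr_pdivrMr// mulrC ltNge small.
Qed.

End NoL1.

(** * Unit vectors of l1 and their differences *)

Section Ell1Vectors.
Context (R : realType).

Lemma ell1_unit_exists (n : nat) : exists x : ell1 R,
  (forall k, val x k = if k == n then 1 else 0) /\ `|x| = 1.
Proof.
pose a : nat -> R^o := fun k => if k == n then 1 else 0.
have sum1 : (\sum_(k <oo) `|a k|%:E = 1)%E.
  rewrite (nneseriesD1 (n := n))// eseries0 ?adde0.
    by rewrite /a eqxx normr1.
  by move=> k _ /= kn; rewrite /a (negbTE kn) normr0.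
have aP : a \in @ell1_pred R by rewrite inE /= sum1 ltry.
exists (exist (fun a => a \in @ell1_pred R) a aP); split=> //.
by apply: EFin_inj; rewrite [LHS]ell1_normE.
Qed.

Lemma ell1_norm_ge (x : ell1 R) (L : nat) (s : nat -> R) :
  (forall n, `|s n| <= 1) -> \sum_(n < L) s n * val x n <= `|x|.
Proof.
move=> s1; rewrite -lee_fin [leRHS]ell1_normE.
apply: le_trans (nneseries_lim_ge L _); last by [].
rewrite big_mkord sumEFin lee_fin; apply: ler_sum => n _.
by rewrite (le_trans (ler_norm _))// normrM ler_piMl.
Qed.

Lemma ell1_valD (x y : ell1 R) n : val (x + y) n = val x n + val y n.
Proof. by []. Qed.

Lemma ell1_valZ (l : R) (x : ell1 R) n : val (l *: x) n = l * val x n.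
Proof. by []. Qed.

Lemma ell1_valB (x y : ell1 R) n : val (x - y) n = val x n - val y n.
Proof. by rewrite -scaleN1r ell1_valD ell1_valZ mulN1r. Qed.

Lemma ell1_val_sum (N : nat) (u : nat -> ell1 R) n :
  val (\sum_(k < N) u k) n = \sum_(k < N) val (u k) n.
Proof.
elim: N => [|N IH]; first by rewrite !big_ord0.
by rewrite big_ord_recr [RHS]big_ord_recr ell1_valD IH.
Qed.

(** Pairing with the indicator [s] of the indices [phi k.*2.+1] gives 1 on each difference, since
    [phi] is injective and parity separates the two families. *)
Lemma ell1_convex_difference (delta : nat -> ell1 R) (phi : nat -> nat) (N : nat)
    (l : nat -> R) :
  (forall n k, val (delta n) k = if k == n then 1 else 0) ->
  (forall j, (phi j < phi j.+1)%N) -> \sum_(k < N) l k = 1 ->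
  1 <= `|\sum_(k < N) l k *: (delta (phi k.*2.+1) - delta (phi k.*2))|.
Proof.
move=> deltaE phiS l1.
have phi_lt i j : (i < j)%N -> (phi i < phi j)%N.
  by elim: j => // j IH; rewrite ltnS leq_eqVlt => /predU1P[->//|/IH/ltn_trans]; apply.
have phi_inj : injective phi.
  move=> i j ij; case: (ltngtP i j) => // /phi_lt; rewrite ij ltnn//.
pose s n : R := if `[< exists k, n = phi k.*2.+1 >] then 1 else 0.
set x := \sum_(k < N) _; set L := phi N.*2.+1.
have s1 n : `|s n| <= 1 by rewrite /s; case: ifP; rewrite ?normr1 ?normr0.
apply: le_trans (ell1_norm_ge x L s1).
rewrite -l1 le_eqVlt; apply/orP; left; apply/eqP.
have -> : \sum_(n < L) s n * val x n = \sum_(n < L) \sum_(k < N)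
    s n * (l k * (val (delta (phi k.*2.+1)) n - val (delta (phi k.*2)) n)).
  apply: eq_bigr => n _; rewrite (ell1_val_sum N (fun k => l k *: (delta (phi k.*2.+1) - delta (phi k.*2)))).
  by rewrite mulr_sumr; apply: eq_bigr => k _; rewrite ell1_valZ ell1_valB.
rewrite exchange_big; apply: eq_bigr => k _ /=.
have sum_delta m : (m < L)%N -> \sum_(n < L) s n * val (delta m) n = s m.
  move=> mL; rewrite (bigD1 (Ordinal mL))//= deltaE eqxx mulr1 big1 ?addr0// => n nm.
  by rewrite deltaE ifF ?mulr0//; apply: contraNF nm => /eqP nm; apply/eqP/val_inj.
have kL (m : nat) : (m <= N.*2)%N -> (phi m < L)%N by move=> mN; apply: phi_lt.
transitivity (l k * (s (phi k.*2.+1) - s (phi k.*2))).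
  have -> : s (phi k.*2.+1) = 1 by rewrite /s asboolT//; exists k.
  have -> : s (phi k.*2) = 0.
    rewrite /s asboolF// => -[j /phi_inj kj].
    by have := congr1 odd kj; rewrite /= !odd_double.
  by rewrite subr0 mulr1.
rewrite -!sum_delta ?kL ?leq_double//; last first.
- by rewrite ltn_double.
- by apply: ltnW.
rewrite -sumrB mulr_sumr; apply: eq_bigr => n _.
by rewrite -mulrBr mulrCA.
Qed.

End Ell1Vectors.

Lemma iota_sum (R : realType) (d : nat) (X : completeNormedModType R) (e : nat -> X)
  (Omega : set 'rV[R]_d.+1) (Omega_open : open Omega)
  (J : completeNormedModType R) (iota : (lebesgue_space R d -> R) -> J)
  (J_JF : is_JF e Omega iota) (f : nat -> lebesgue_space R d -> R) (l : nat -> R) N :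
  (forall k, L1 Omega (f k)) ->
  iota (fun x => \sum_(k < N) l k * f k x) = \sum_(k < N) l k *: iota (f k).
Proof.
have [lin _ _] := J_JF; move=> fL.
have iota0 : iota (fun=> 0) = 0.
  have := lin 1 _ _ (L1_0 Omega) (L1_0 Omega).
  under [X in iota X]eq_fun do rewrite mulr0 addr0.
  by rewrite scale1r => /esym/eqP; rewrite -subr_eq0 addrK => /eqP.
elim: N => [|N IH].
  by rewrite big_ord0 -iota0; congr iota; apply/funext => x; rewrite big_ord0.
rewrite big_ord_recr /= -IH addrC -lin//; last exact: L1_sum.
by congr iota; apply/funext => x; rewrite big_ord_recr /= addrC.
Qed.

Theorem theoremA (R : realType) (d : nat)
  (X : completeNormedModType R) (e : nat -> X)
  (X_reflexive : reflexive_space X)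
  (e_basis : schauder_basis e) (e_symmetric : one_symmetric e)
  (Omega : set 'rV[R]_d.+1) (Omega_nonempty : Omega !=set0)
  (Omega_open : open Omega) (Omega_bounded : bounded_set Omega)
  (J : completeNormedModType R) (iota : (lebesgue_space R d -> R) -> J)
  (J_JF : is_JF e Omega iota) :
  ~ contains_copy (ell1 R) J.
Proof.
move=> [T [c [C [c0 TP]]]].
have [lin isom iota_dense] := J_JF.
have /choice[delta deltaP] := @ell1_unit_exists R.
(* Perturbing each vector by c / 4 moves convex combinations of differences by at most c / 2, half
   of the lower bound [c] that the embedding gives them. *)
have c4 : 0 < c / 4 by lra.
have /choice[f fP] n : exists f, L1 Omega f /\ `|T (delta n) - iota f| < c / 4.
  have [|y [By [f fL fy]]] := iota_dense (ball (T (delta n)) (c / 4)) _ (ball_open _ _).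
    by exists (T (delta n)); exact: ballxx.
  by exists f; split=> //; rewrite fy; move: By; rewrite -ball_normE.
have fL n : L1 Omega (f n) by have [] := fP n.
pose C' := C + c / 4.
have iotaC n : `|iota (f n)| <= C'.
  have -> : iota (f n) = T (delta n) - (T (delta n) - iota (f n)) by rewrite opprB addrC subrK.
  rewrite (le_trans (ler_normB _ _))// lerD//; last by have [_ /ltW] := fP n.
  by have /andP[_] := TP (delta n); rewrite (deltaP n).2 mulr1.
have fC n : (JF_norm e Omega (f n) <= C'%:E)%E by rewrite -isom// lee_fin.
have [phi [phiS phiP]] := JF_selection e_basis e_symmetric X_reflexive Omega_open fL fC.
(* The Cauchy property along [phi] makes these differences null on every box, and using disjoint
   pairs of indices prevents cancellation in l1. *)
pose g k x := -1 * f (phi k.*2) x + f (phi k.*2.+1) x.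
have gL k : L1 Omega (g k) by exact: L1_lin.
have iota_g k : iota (g k) = iota (f (phi k.*2.+1)) - iota (f (phi k.*2)).
  by rewrite /g lin// scaleN1r addrC.
have gC k : (JF_norm e Omega (g k) <= (C' + C')%:E)%E.
  by rewrite -isom// lee_fin iota_g (le_trans (ler_normB _ _))// lerD.
have g0 p : proper_box Omega p -> forall eps : R, 0 < eps ->
    exists K, forall k, (K <= k)%N -> `|box_integral (g k) p| < eps.
  move=> pP eps eps0; have [K KP] := phiP p pP eps eps0; exists K => k Kk.
  rewrite (box_integral_lin Omega_open _ pP.1 (fL _) (fL _)) mulN1r addrC.
  by apply: KP; rewrite -addnn ?ltnS ?leqW// (leq_trans Kk)// leq_addr.
have c2 : 0 < c / 2 by lra.
have [N [l [l0 l1]]] := JF_convex_combination_small e_basis e_symmetric X_reflexive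
  Omega_open Omega_bounded gL gC g0 c2.
rewrite -isom; last exact: L1_sum.
rewrite lte_fin (iota_sum Omega_open J_JF l N gL) ltNge => /negP; apply.
pose D n : J := T (delta n) - iota (f n).
have DE k : iota (g k) = T (delta (phi k.*2.+1) - delta (phi k.*2)) - (D (phi k.*2.+1) - D (phi k.*2)).
  have iE n : iota (f n) = T (delta n) - D n by rewrite /D opprB addrC subrK.
  by rewrite iota_g raddfB !iE !opprD addrACA.
have -> : \sum_(k < N) l k *: iota (g k) =
    T (\sum_(k < N) l k *: (delta (phi k.*2.+1) - delta (phi k.*2))) -
    \sum_(k < N) l k *: (D (phi k.*2.+1) - D (phi k.*2)).
  rewrite raddf_sum -sumrB; apply: eq_bigr => k _.
  by rewrite DE [LHS]scalerBr; congr (_ - _); exact/esym/linearZZ.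
apply: le_trans (lerB_dist _ _).
have low := ell1_convex_difference (fun n => (deltaP n).1) phiS l1.
have /andP[{}low' _] := TP (\sum_(k < N) l k *: (delta (phi k.*2.+1) - delta (phi k.*2))).
have up : `|\sum_(k < N) l k *: (D (phi k.*2.+1) - D (phi k.*2))| <= c / 2.
  apply: (le_trans (ler_norm_sum _ _ _)).
  have -> : c / 2 = \sum_(k < N) l k * (c / 2) by rewrite -mulr_suml l1 mul1r.
  apply: ler_sum => k _.
  rewrite normrZ ger0_norm// ler_wpM2l// (le_trans (ler_normB _ _))//.
  by have [_] := fP (phi k.*2.+1); have [_] := fP (phi k.*2); rewrite /D; lra.
have := ler_wpM2l (ltW c0) low.
by lra.
Qed.
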